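(* Let $G$ be a chordal graph with $n$ vertices and $k$ connected components. Then the polynomial $(-1)^{n-k}\mu_G(t)$ is $\gamma$-positive.
   Context: All graphs are finite and simple. A graph is chordal if it has no induced cycle of length greater than $3$. Weighted partitions. A weighted partition of a finite set $S$ is a set $\boldsymbol{\pi}=\{B_1^{v_1},\dots,B_k^{v_k}\}$ where $\{B_1,\dots,B_k\}$ is a partition of $S$ (the underlying partition of $\boldsymbol\pi$) and each weight $v_i\in\{0,1,\dots,|B_i|-1\}$. The poset $\mathcal W\Pi_S$ consists of all weighted partitions of $S$, with $\{A_1^{w_1},\dots,A_j^{w_j}\}\le\{B_1^{v_1},\dots,B_k^{v_k}\}$ iff $\{A_1,\dots,A_j\}$ refines $\{B_1,\dots,B_k\}$ and, whenever $B_m=A_{i_1}\cup\dots\cup A_{i_l}$, one has $v_m-(w_{i_1}+\dots+w_{i_l})\in\{0,1,\dots,l-1\}$. For a graph $G=(V,E)$, the bond lattice $\Pi_G$ is the set of partitions of $V$ all of whose blocks induce connected subgraphs of $G$, ordered by refinement. The weighted bond poset $\mathcal W\Pi_G$ is the induced subposet of $\mathcal W\Pi_V$ consisting of weighted partitions whose underlying partition is in $\Pi_G$. Its minimum element $\hat 0$ has all blocks singletons of weight $0$. The Möbius polynomial of $G$ is $$\mu_G(t)=\sum_{\boldsymbol\pi}\mu_{\mathcal W\Pi_G}(\hat 0,\boldsymbol\pi)\,t^{w(\boldsymbol\pi)},$$ the sum being over maximal elements $\boldsymbol\pi$ of $\mathcal W\Pi_G$, where $w(\boldsymbol\pi)$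 is the sum of the weights of the blocks and $\mu_P$ is the Möbius function of a poset $P$. It has degree $n-k$. A polynomial $p(t)\in\mathbb R[t]$ of degree $d$ is $\gamma$-positive if $p(t)=\sum_{j=0}^{\lfloor d/2\rfloor}\gamma_j t^j(1+t)^{d-2j}$ for some real $\gamma_j\ge 0$. *)

(* Defs.v *)
From HB Require Import structures.
From mathcomp Require Import all_boot all_order all_algebra.
From mathcomp Require Import reals.
Set Implicit Arguments.
Unset Strict Implicit.
Unset Printing Implicit Defensive.
Import Order.TTheory GRing.Theory Num.Theory.

(* A finite simple graph is a symmetric, irreflexive [e : rel T] on a finType;
   the definitions below only mention [e], and the two properties are
   hypotheses wherever they are needed. *)

Section Graphs.
Variables (T : finType) (e : rel T).

Definition induced (B : {set T}) : rel T :=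
  [rel x y | [&& x \in B, y \in B & e x y]].

Definition connected_block (B : {set T}) : bool :=
  [forall x in B, [forall y in B, connect (induced B) x y]].

(* [c] lists the distinct vertices of a cycle in cyclic order.  The bound on
   [size c] excludes the degenerate [ucycle]s, such as one edge traversed in
   both directions. *)
Definition induced_cycle (c : seq T) : Prop :=
  [/\ 2 < size c, ucycle e c &
      {in c &, forall x y, e x y -> y = next c x \/ x = next c y}].

Definition chordal : Prop := forall c, induced_cycle c -> size c <= 3.

Definition is_bond (P : {set {set T}}) : bool :=
  partition P [set: T] && [forall B in P, connected_block B].

End Graphs.

Section Mobius.
Variables (d : Order.disp_t) (P : finPOrderType d).

(* The first argument is fuel: chains of [P] have at most #|P| elements, so
   [mobius] satisfies the usual recursion, see [mobius_refl] and
   [mobius_neq]. *)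
Fixpoint mobius_rec (n : nat) (x y : P) : int :=
  if n is m.+1 then
    if x == y then 1%R
    else (- \sum_(z : P | (x <= z < y)%O) mobius_rec m x z)%R
  else 0%R.

Definition mobius (x y : P) : int := mobius_rec #|P| x y.

Definition maximal_elt (x : P) : bool := [forall y : P, ~~ (x < y)%O].

Lemma mobius_rec_fuel n (x y : P) :
  #|[pred z | (z <= y)%O]| <= n -> mobius_rec n x y = mobius x y.
Proof.
rewrite /mobius; have: #|[pred z | (z <= y)%O]| <= #|P| by apply: max_card.
elim: n #|P| y => [|n IHn] [|m] y //=.
- by move=> _; rewrite leqn0 => /eqP/card0_eq/(_ y); rewrite inE lexx.
- by rewrite leqn0 => /eqP/card0_eq/(_ y); rewrite inE lexx.
move=> ym yn; case: eqP => // _; congr (- _)%R.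
apply: eq_bigr => z /andP[_ ltzy].
have lt_card: #|[pred t | (t <= z)%O]| < #|[pred t | (t <= y)%O]|.
  apply: proper_card; apply/properP; split.
    by apply/subsetP=> t; rewrite !inE => /le_trans; apply; apply: ltW.
  by exists y; rewrite !inE ?lexx ?(lt_geF ltzy).
by apply: IHn; rewrite -ltnS; apply: leq_trans lt_card _.
Qed.

Lemma mobius_refl (x : P) : mobius x x = 1%R.
Proof.
rewrite -(@mobius_rec_fuel #|P|.+1) /= ?eqxx //.
exact: leq_trans (max_card _) _.
Qed.

Lemma mobius_neq (x y : P) :
  x != y -> mobius x y = (- \sum_(z : P | (x <= z < y)%O) mobius x z)%R.
Proof.
move=> xy; rewrite -(@mobius_rec_fuel #|P|.+1) /= ?(negPf xy) //.
exact: leq_trans (max_card _) _.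
Qed.

End Mobius.

Section WeightedPartitions.
Variable T : finType.

(* Weights of blocks are less than the size of the block, so that the range
   of the weight type is immaterial; ['I_#|T|.+1] makes the type finite while
   providing [ord0] even if [T] is empty. *)
Implicit Types pi rho sigma : {set {set T} * 'I_#|T|.+1}.

Definition blocks pi : {set {set T}} := [set b.1 | b in pi].

Definition is_wpart pi : bool :=
  [&& partition (blocks pi) [set: T],
      [forall a in pi, [forall b in pi, (a.1 == b.1) ==> (a == b)]] &
      [forall b in pi, b.2 < #|b.1|]].

Record wpart : predArgType := WPart
  { wpart_val :> {set {set T} * 'I_#|T|.+1}; _ : is_wpart wpart_val }.

HB.instance Definition _ := [isSub for wpart_val].
HB.instance Definition _ := [Finite of wpart by <:].

Definition refines (P Q : {set {set T}}) : bool :=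
  [forall A in P, [exists B in Q, A \subset B]].

Definition weight pi : nat := \sum_(b in pi) b.2.

Definition below pi (B : {set T}) := [set a in pi | a.1 \subset B].

(* The condition "v - (w_1 + ... + w_l) is in {0, ..., l - 1}", in nat. *)
Definition wpart_le pi rho : bool :=
  refines (blocks pi) (blocks rho) &&
  [forall b in rho,
     weight (below pi b.1) <= b.2 < weight (below pi b.1) + #|below pi b.1|].

Lemma wpart_sub (p : wpart) a b x :
  a \in (p : {set _}) -> b \in (p : {set _}) -> x \in a.1 -> x \in b.1 -> a = b.
Proof.
case: p => p /= /and3P[/and3P[_ /trivIsetP tI _] /forall_inP inj _].
move=> pa pb xa xb; apply/eqP/(implyP (forall_inP (inj a pa) b pb)).
apply: contraTT xb => /tI; rewrite !imset_f // => /(_ isT isT).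
by move/disjointFr => ->.
Qed.

Lemma wpart_neq0 (p : wpart) a :
  a \in (p : {set _}) -> exists x, x \in a.1.
Proof.
case: p => p /= /and3P[/and3P[_ _ n0] _ _] pa; apply/set0Pn.
by apply: contraNneq n0 => <-; apply: imset_f.
Qed.

Lemma refinesP pi rho : reflect
  (forall a, a \in pi -> exists2 b, b \in rho & a.1 \subset b.1)
  (refines (blocks pi) (blocks rho)).
Proof.
apply: (iffP forall_inP) => H.
  move=> a pa; have /H/exists_inP[B] : a.1 \in blocks pi by exact: imset_f.
  by move=> /imsetP[b rb ->] ab; exists b.
move=> A /imsetP[a /H[b rb ab] ->]; apply/exists_inP; exists b.1 => //.
exact: imset_f.
Qed.

Lemma below_self (p : wpart) a :
  a \in (p : {set _}) -> below p a.1 = [set a].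
Proof.
move=> pa; apply/setP=> b; rewrite !inE.
apply/andP/eqP => [[pb ba]|->]; last by rewrite subxx.
have [x xb] := wpart_neq0 pb.
exact: (wpart_sub pb pa xb (subsetP ba x xb)).
Qed.

Fact wpart_le_refl : reflexive (fun p q : wpart => wpart_le p q).
Proof.
move=> p; apply/andP; split; first by apply/refinesP=> a pa; exists a.
apply/forall_inP=> a pa.
by rewrite /weight below_self // big_set1 cards1 addn1 leqnn ltnSn.
Qed.

Lemma wpart_le_anti_sub (p q : wpart) :
  wpart_le p q -> wpart_le q p -> (p : {set _}) \subset q.
Proof.
move=> /andP[/refinesP pq /forall_inP Hpq] /andP[/refinesP qp _].
apply/subsetP=> a pa.
have [b qb ab] := pq a pa; have [c pc bc] := qp b qb.
have [x xa] := wpart_neq0 pa.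
have Eac : a = c.
  by apply: (wpart_sub pa pc xa); apply/(subsetP bc)/(subsetP ab).
have E : a.1 = b.1 by apply/eqP; rewrite eqEsubset ab Eac bc.
have := Hpq b qb; rewrite -E /weight below_self // big_set1 cards1 addn1 ltnS.
rewrite -eqn_leq => /eqP/val_inj E2.
suff -> : a = b by [].
by apply/eqP; rewrite -pair_eqE /= E E2 !eqxx.
Qed.

Fact wpart_le_anti : antisymmetric (fun p q : wpart => wpart_le p q).
Proof.
move=> p q /andP[pq qp]; apply/val_inj/eqP; rewrite eqEsubset.
by rewrite !wpart_le_anti_sub.
Qed.

Lemma sum_below (p q r : wpart) c (F : {set T} * 'I_#|T|.+1 -> nat) :
  refines (blocks p) (blocks q) -> refines (blocks q) (blocks r) ->
  c \in (r : {set _}) ->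
  \sum_(a in below p c.1) F a =
  \sum_(b in below q c.1) \sum_(a in below p b.1) F a.
Proof.
move=> /refinesP pq /refinesP qr rc.
rewrite (exchange_big_dep (mem (p : {set _}))) /=; last first.
  by move=> b a _; rewrite inE => /andP[].
rewrite [LHS](eq_bigl (fun a => (a \in (p : {set _})) && (a.1 \subset c.1)));
  last by move=> a; rewrite inE.
rewrite big_mkcondr /=; apply: eq_bigr => a pa.
have [x xa] := wpart_neq0 pa.
case: ifP => ac.
  have [b qb ab] := pq a pa; have [c' rc' bc'] := qr b qb.
  have xb := subsetP ab x xa.
  have Ec := wpart_sub rc' rc (subsetP bc' x xb) (subsetP ac x xa).
  rewrite (big_pred1 b) // => b' /=; rewrite !inE pa /=.
  apply/andP/eqP => [[/andP[qb' _] ab']|->]; last by rewrite qb ab -Ec bc'.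
  exact: (wpart_sub qb' qb (subsetP ab' x xa) xb).
rewrite big_pred0 // => b; rewrite !inE; apply/negP=> /andP[/andP[_ bc] /andP[_ ab]].
by rewrite (subset_trans ab bc) in ac.
Qed.

Fact wpart_le_trans : transitive (fun p q : wpart => wpart_le p q).
Proof.
move=> q p r /andP[pq /forall_inP Hpq] /andP[qr /forall_inP Hqr].
apply/andP; split.
  apply/refinesP=> a /(refinesP _ _ pq)[b /(refinesP _ _ qr)[c rc bc] ab].
  by exists c => //; apply: subset_trans bc.
apply/forall_inP=> c rc; have /andP[lb ub] := Hqr c rc.
rewrite -sum1_card /weight !(sum_below _ pq qr rc); apply/andP; split.
  apply: leq_trans lb; apply: leq_sum => b; rewrite inE => /andP[qb _].
  by have /andP[] := Hpq b qb.
apply: leq_trans ub _; rewrite -sum1_card /weight -!big_split /=.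
apply: leq_sum => b; rewrite inE => /andP[qb _].
by rewrite sum1_card addn1; have /andP[] := Hpq b qb.
Qed.

Fact wpart_display : Order.disp_t. Proof. exact: (Order.Disp tt tt). Qed.

HB.instance Definition _ :=
  Order.Le_isPOrder.Build wpart_display wpart
    wpart_le_refl wpart_le_anti wpart_le_trans.

End WeightedPartitions.

Section WeightedBondPoset.
Variables (T : finType) (e : rel T).

Record wbond : predArgType :=
  WBond { wbond_val :> wpart T; _ : is_bond e (blocks wbond_val) }.

HB.instance Definition _ := [isSub for wbond_val].
HB.instance Definition _ := [Finite of wbond by <:].
HB.instance Definition _ :=
  [SubChoice_isSubPOrder of wbond by <: with wpart_display].

Definition wbond0_set : {set {set T} * 'I_#|T|.+1} :=
  [set ([set x], ord0) | x : T].

Lemma blocks_wbond0 : blocks wbond0_set = [set [set x] | x : T].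
Proof. by rewrite /blocks -imset_comp. Qed.

Lemma partition_wbond0 : partition (blocks wbond0_set) [set: T].
Proof.
rewrite blocks_wbond0; apply/and3P; split.
- apply/eqP/setP=> x; rewrite inE; apply/bigcupP.
  by exists [set x]; rewrite ?inE ?imset_f.
- apply/trivIsetP=> _ _ /imsetP[x _ ->] /imsetP[y _ ->] xy.
  by rewrite disjoints1 inE; apply: contraNneq xy => ->.
by apply/imsetP=> -[x _ /setP/(_ x)]; rewrite !inE eqxx.
Qed.

Fact is_wpart_wbond0 : is_wpart wbond0_set.
Proof.
apply/and3P; split; first exact: partition_wbond0.
  apply/forall_inP => _ /imsetP[x _ ->]; apply/forall_inP => _ /imsetP[y _ ->].
  by apply/implyP=> /= /eqP ->.
by apply/forall_inP=> _ /imsetP[x _ ->] /=; rewrite cards1.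
Qed.

Fact is_bond_wbond0 : is_bond e (blocks (WPart is_wpart_wbond0)).
Proof.
rewrite /is_bond partition_wbond0 blocks_wbond0 /=.
apply/forall_inP=> _ /imsetP[x _ ->].
apply/forall_inP => y /set1P->; apply/forall_inP => z /set1P->.
exact: connect0.
Qed.

Definition wbond0 : wbond := WBond is_bond_wbond0.

Lemma wbond0_le (p : wbond) : (wbond0 <= p)%O.
Proof.
case: p => -[p wp] bp.
rewrite leEsub /= /Order.le /=; move: (wp) => /and3P[part _ /forall_inP lt_w].
apply/andP; split.
  apply/refinesP=> _ /imsetP[x _ ->] /=.
  move: part => /and3P[/eqP/setP/(_ x)]; rewrite inE => /bigcupP[_ /imsetP[b pb ->] xb] _ _.
  by exists b => //; rewrite sub1set.
apply/forall_inP=> b pb.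
have E : below wbond0_set b.1 = [set ([set x], ord0) | x in b.1].
  apply/setP=> a; rewrite inE; apply/andP/imsetP => [[/imsetP[x _ ->]]|[x xb ->]].
    by rewrite sub1set => xb; exists x.
  by rewrite imset_f ?inE //= sub1set.
rewrite E card_imset; last by move=> x y [/set1_inj].
rewrite /weight big1 ?add0n ?lt_w // => _ /imsetP[x _ ->] //.
Qed.

Definition mobius_poly : {poly int} :=
  (\sum_(p : wbond | maximal_elt p) mobius wbond0 p *: 'X^(weight p))%R.

End WeightedBondPoset.

Local Open Scope ring_scope.

(* The degree [d] is the actual degree of [p]; in particular p != 0. *)
Definition gamma_positive (R : realType) (p : {poly R}) : Prop :=
  exists (d : nat) (gamma : nat -> R),
    [/\ size p = d.+1,
        forall j, (j <= d./2)%N -> 0 <= gamma j &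
        p = \sum_(0 <= j < d./2.+1)
              gamma j *: ('X^j * (1 + 'X) ^+ (d - 2 * j))].

(* Main.v *)
(* Let M_B be the polynomial whose coefficients are the Moebius values of the
   intervals ending at a single weighted block B.  Intervals of the weighted
   bond poset factor over blocks, so the Moebius polynomial of G is the product
   of the M_C over the components C, and the M_B are determined by
   sum_pi [|pi|]_t prod_(B in pi) M_B = 0, where pi runs over the bond
   partitions of a connected S with at least two vertices.  Equivalently
   P_S(1) = P_S(t), where P_S(q) = sum_pi prod_(B in pi) (q M_B).

   Fix a vertex a.  On the connected sets containing a, this identity for the
   contraction G/A says that the matrices X(A,B) = M_((G/A)[B/A]) and
   Y(A,B) = P_(B - A)(1) - t P_(B - A)(t) satisfy X Y = (1 - t) I, whence
   Y X = (1 - t) I.  If a is simplicial, then C - a is connected whenever C is,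
   and the entry ({a}, V) of Y X reads
     M_V = sum_C (- w_(C - a)) M_(V/C),
   with w_H = 1 + t if H is a single vertex and w_H = P_H(1) otherwise; the
   numbers - P_V(1) satisfy a similar recursion.  Chordal graphs have simplicial
   vertices and this property is inherited by contractions, so an induction
   writes M_V and - P_V(1) as nonnegative combinations of the products
   (- (1 + t))^i t^j with i + 2 j = |V| - 1 and i + 2 j = |V| respectively. *)
Require Import Defs.
From mathcomp Require Import all_boot all_order all_algebra reals.
From mathcomp Require Import zify ring.
Set Implicit Arguments.
Unset Strict Implicit.
Unset Printing Implicit Defensive.
Import Order.TTheory GRing.Theory Num.Theory.

(** * Connectedness, contraction and simplicial vertices *)

Section Connectivity.
Variable T : finType.
Implicit Types (e : rel T) (a v x y z : T) (A B C L S V X : {set T}).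

(* Connectedness by cuts, better suited than paths to deletions and
   contractions. *)
Definition conn e S : bool :=
  (S != set0) &&
  [forall X : {set T}, (X != set0) && (X \proper S) ==>
     [exists x in X, [exists y in S :\: X, e x y]]].

Lemma connP e S : reflect
  (S != set0 /\ forall X, X != set0 -> X \proper S ->
     exists x y, [/\ x \in X, y \in S, y \notin X & e x y])
  (conn e S).
Proof.
apply: (iffP andP) => -[S0 H]; split => //.
  move=> X X0 XS; move/forallP/(_ X): H; rewrite X0 XS => /exists_inP[x xX].
  by case/exists_inP=> y /setDP[yS yX] exy; exists x, y.
apply/forallP=> X; apply/implyP=> /andP[X0 XS].
have [x [y [xX yS yX exy]]] := H X X0 XS.
by apply/exists_inP; exists x => //; apply/exists_inP; exists y; rewrite ?inE ?yX.
Qed.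

Lemma conn_neq0 e S : conn e S -> S != set0.
Proof. by case/andP. Qed.

Lemma conn1 e x : conn e [set x].
Proof.
apply/connP; split=> [|X X0]; first by apply/set0Pn; exists x; rewrite inE.
by rewrite properE subset1 (negPf X0) orbF => /andP[/eqP->]; rewrite subxx.
Qed.

Lemma eq_conn e e' S :
  {in S &, forall x y, x != y -> e x y = e' x y} -> conn e S = conn e' S.
Proof.
move=> ee; apply/connP/connP => -[S0 H]; split=> // X X0 XS;
  have [x [y [xX yS yX exy]]] := H X X0 XS; exists x, y; split=> //;
  (have xy : x != y by apply: (contraNneq _ yX) => <-);
  have xS := subsetP (proper_sub XS) x xX; by move: exy; rewrite ee.
Qed.

Lemma conn_connected_block e S :
  S != set0 -> conn e S = connected_block e S.
Proof.
move=> S0; apply/connP/forall_inP => [[_ H] x xS|H].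
  apply/forall_inP=> y yS; apply: contraT => nxy.
  pose X := [set z in S | connect (induced e S) x z].
  have X0 : X != set0 by apply/set0Pn; exists x; rewrite inE xS connect0.
  have XS : X \proper S.
    apply/properP; split; first by apply/subsetP=> z; rewrite inE => /andP[].
    by exists y; rewrite // inE yS (negPf nxy).
  have [u [w [uX wS wX euw]]] := H X X0 XS.
  move: uX wX; rewrite !inE wS /= => /andP[uS cu] /negP[].
  by apply: connect_trans cu (connect1 _); apply/and3P.
split=> // X X0 /properP[XS [y yS yX]].
have [x xX] := set0Pn _ X0; have xS := subsetP XS x xX.
have /connectP[p] := forall_inP (H x xS) y yS.
elim: p x xX {xS} => [|z p IHp] x xX /=.
  by move=> _ yx; rewrite yx xX in yX.
case/andP=> /and3P[xS zS exz] pz ylast.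
case zX: (z \in X); first exact: (IHp z).
by exists x, z; rewrite zX.
Qed.

Lemma conn_cut e S C : conn e S -> C \subset S -> C != set0 ->
  (forall x y, x \in C -> y \in S -> e x y -> y \in C) -> C = S.
Proof.
move=> /connP[_ H] CS C0 cl; apply/eqP; apply: contraT => nCS.
have [|x [y [xC yS yC exy]]] := H C C0; first by rewrite properEneq nCS.
by rewrite (cl x y) in yC.
Qed.

(* [identify e A a] is the graph obtained by merging the vertices of [A] into
   the representative [a]; its vertex set is [(S :\: A) :|: [set a]]. *)
Definition fiber A a x : {set T} := if x == a then A else [set x].

Definition identify e A a : rel T :=
  [rel x y | (x != y) &&
     [exists u in fiber A a x, [exists v in fiber A a y, e u v]]].

Definition quot A a S : {set T} := a |: S :\: A.

Lemma identifyP e A a x y : reflect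
  (x != y /\ exists u v, [/\ u \in fiber A a x, v \in fiber A a y & e u v])
  (identify e A a x y).
Proof.
apply: (iffP andP) => -[xy].
  by case/exists_inP=> u uA /exists_inP[v vA euv]; split=> //; exists u, v.
case=> u [v [uA vA euv]]; split=> //; apply/exists_inP; exists u => //.
by apply/exists_inP; exists v.
Qed.

Lemma identify_sym e A a : symmetric e -> symmetric (identify e A a).
Proof.
move=> es x y; apply/identifyP/identifyP => -[xy [u [v [uA vA euv]]]];
  (split; first by rewrite eq_sym); exists v, u; by rewrite es.
Qed.

Lemma identifyE e A a x y :
  x != a -> y != a -> x != y -> identify e A a x y = e x y.
Proof.
move=> xa ya xy; rewrite /identify /= xy /fiber (negPf xa) (negPf ya).
apply/exists_inP/idP => [[u /set1P-> /exists_inP[v /set1P->]] //|exy].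
by exists x; rewrite ?inE //; apply/exists_inP; exists y; rewrite ?inE.
Qed.

Lemma identify1 e a x y : x != y -> identify e [set a] a x y = e x y.
Proof.
have f1 z : fiber [set a] a z = [set z] by rewrite /fiber; case: eqP => [->|].
move=> xy; rewrite /identify /= xy !f1.
apply/exists_inP/idP => [[u /set1P-> /exists_inP[v /set1P->]] //|exy].
by exists x; rewrite ?inE //; apply/exists_inP; exists y; rewrite ?inE.
Qed.

Lemma quot1 a S : a \in S -> quot [set a] a S = S.
Proof. exact: setD1K. Qed.

Lemma quot_id A a : quot A a A = [set a].
Proof. by rewrite /quot setDv setU0. Qed.

Lemma quot_in A a S x : a \in A -> x \in quot A a S -> x != a -> (x \in S) && (x \notin A).
Proof. by move=> aA; rewrite !inE => /orP[->//|/andP[-> ->]]. Qed.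

Lemma card_quot A a S : a \in A -> A \subset S -> #|quot A a S| + #|A| = #|S|.+1.
Proof.
move=> aA AS; rewrite cardsU1 inE aA /= add1n addSn; congr _.+1.
by rewrite -[RHS](cardsID A) (setIidPr AS) addnC.
Qed.

(** A cut [X] of the quotient is pulled back to the union [L] of the fibers over [X]; an edge of [e]
    leaving [L] projects to an edge leaving [X]. *)
Lemma conn_quot e A a S : symmetric e -> a \in A -> A \subset S ->
  conn e S -> conn (identify e A a) (quot A a S).
Proof.
move=> es aA AS /connP[S0 H]; apply/connP; split.
  by apply/set0Pn; exists a; rewrite !inE eqxx.
move=> X X0 /properP[XQ [y0 y0Q y0X]].
pose L := X :\ a :|: (if a \in X then A else set0).
have LX x : x \in quot A a S -> forall u, u \in fiber A a x -> (u \in L) = (x \in X).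
  move=> xQ u; rewrite /fiber; case: eqP => [->|/eqP xa].
    move=> uA; rewrite !inE; case: ifP => aX; rewrite ?inE ?uA ?orbT ?andbF ?orbF //.
    apply/negP=> /andP[ua uX].
    by have /andP[_] := quot_in aA (subsetP XQ _ uX) ua; rewrite uA.
  move/set1P->; have /andP[_ xA] := quot_in aA xQ xa.
  by rewrite !inE xa /=; case: ifP; rewrite ?inE ?(negPf xA) orbF.
have lift u : u \in S -> exists2 x, x \in quot A a S & u \in fiber A a x.
  move=> uS; case uA: (u \in A); first by exists a; rewrite ?inE /fiber ?eqxx.
  exists u; first by rewrite !inE uS uA orbT.
  by rewrite /fiber; case: eqP => [ua|]; rewrite ?inE //; rewrite ua aA in uA.
have fS x u : x \in quot A a S -> u \in fiber A a x -> u \in S.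
  move=> xQ; rewrite /fiber; case: eqP => [_|/eqP xa]; first exact: (subsetP AS).
  by move/set1P->; case/andP: (quot_in aA xQ xa).
have fn0 x : exists u, u \in fiber A a x.
  by rewrite /fiber; case: eqP => _; [exists a | exists x; rewrite inE].
have [x0 x0X] := set0Pn _ X0; have [u0 u0f] := fn0 x0; have [w0 w0f] := fn0 y0.
have [||u [w [uL wS wL euw]]] := H L.
- by apply/set0Pn; exists u0; rewrite (LX x0) // (subsetP XQ).
- apply/properP; split.
    apply/subsetP=> u; rewrite !inE => /orP[/andP[ua uX]|].
      by case/andP: (quot_in aA (subsetP XQ _ uX) ua).
    by case: ifP; rewrite ?inE // => _; apply: (subsetP AS).
  by exists w0; [apply: (fS y0) | rewrite (LX y0)].
have uS : u \in S.
  move: uL; rewrite !inE => /orP[/andP[ua uX]|].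
    by case/andP: (quot_in aA (subsetP XQ _ uX) ua).
  by case: ifP; rewrite ?inE // => _; apply: (subsetP AS).
have [x xQ ux] := lift u uS; have [y yQ wy] := lift w wS.
rewrite (LX x) // in uL; rewrite (LX y) // in wL.
exists x, y; split=> //; apply/identifyP; split; last by exists u, w.
by apply: contraNneq wL => <-.
Qed.

(** If no edge of [S] leaves [X], the connected set [A] lies inside [X] or is disjoint from it.
    Either way [X] descends to a cut of the quotient, and an edge crossing that cut lifts to an edge
    leaving [X]. *)
Lemma conn_unquot e A a S : symmetric e -> a \in A -> A \subset S -> conn e A ->
  conn (identify e A a) (quot A a S) -> conn e S.
Proof.
move=> es aA AS Ac /connP[_ H]; apply/connP; split.
  by apply/set0Pn; exists a; apply: (subsetP AS).
move=> X X0 /properP[XS [y0 y0S y0X]].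
case: (boolP [exists x in X, [exists y in S :\: X, e x y]]).
  by move=> /exists_inP[x xX /exists_inP[y /setDP[yS yX] exy]]; exists x, y.
move=> ncut.
have cl x y : x \in X -> y \in S -> e x y -> y \in X.
  move=> xX yS exy; apply: contraNT ncut => yX; apply/exists_inP; exists x => //.
  by apply/exists_inP; exists y; rewrite ?inE ?yX.
have clV x y : x \in S -> y \in X -> e x y -> x \in X.
  by move=> xS yX exy; apply: (cl y) => //; rewrite es.
have [AX|AX] : A \subset X \/ [disjoint A & X].
  case: (boolP (A :&: X == set0)) => [|AX0]; first by rewrite setI_eq0; right.
  left; apply/setIidPl; apply: conn_cut Ac (subsetIl _ _) AX0 _ => x y.
  rewrite !inE => /andP[_ xX] yA exy; rewrite yA (cl x) //; exact: (subsetP AS).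
- have [||x [y [xq yQ yq /identifyP[xy [u [v [uf vf euv]]]]]]] := H (quot A a X).
  + by apply/set0Pn; exists a; rewrite !inE eqxx.
  + apply/properP; split.
      by apply: setUS; apply: setSD.
    exists y0; rewrite !inE ?(negPf y0X) ?y0S ?andbT ?orbF.
      by rewrite (contraNN (subsetP AX y0) y0X) orbT.
    by rewrite andbF orbF; apply: contraNneq y0X => ->; apply: (subsetP AX).
  have uX : u \in X.
    move: uf; rewrite /fiber; case: eqP => [_|/eqP xa]; first exact: (subsetP AX).
    by move/set1P->; case/andP: (quot_in aA xq xa).
  have ya : y != a by apply: contraNneq yq => ->; rewrite !inE eqxx.
  move: vf; rewrite /fiber (negPf ya) => /set1P vy; subst v.
  have /andP[yS yA] := quot_in aA yQ ya.
  by move: yq; rewrite !inE (negPf ya) yA (cl u).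
have aX : a \notin X by rewrite (disjointFr AX).
have XQ : X \subset quot A a S.
  apply/subsetP=> x xX; rewrite !inE (subsetP XS) // andbT.
  by rewrite (disjointFl AX) // orbT.
have [|x [y [xq yQ yq /identifyP[xy [u [v [uf vf euv]]]]]]] := H X X0.
  by apply/properP; split=> //; exists a; rewrite // !inE eqxx.
have xa : x != a by apply: contraNneq aX => <-.
move: uf; rewrite /fiber (negPf xa) => /set1P ux; subst u.
exists x, v; split=> //; move: vf; rewrite /fiber; case: eqP => [_|/eqP ya].
- exact: (subsetP AS).
- by move/set1P->; case/andP: (quot_in aA yQ ya).
- by move=> vA; rewrite (disjointFr AX).
- by move/set1P->.
Qed.

Definition simplicial e S z : Prop :=
  z \in S /\
  forall x y, x \in S -> y \in S -> x != y -> e z x -> e z y -> e x y.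

(** Chordality in the form used by the induction: a perfect elimination order can be started in
    every nonempty subset. It restricts to subsets at once and passes to contractions by
    [simplicial_hereditary_quot]. *)
Definition simplicial_hereditary e V : Prop :=
  forall S, S \subset V -> S != set0 -> exists z, simplicial e S z.

Lemma conn_nbr e S z : conn e S -> z \in S -> 1 < #|S| ->
  exists w, [/\ w \in S, w != z & e z w].
Proof.
move=> /connP[_ H] zS S1; have [||x [y [/set1P-> yS]]] := H [set z].
- by apply/set0Pn; exists z; rewrite inE.
- rewrite properE sub1set zS /=; apply: contraL S1 => /subset_leq_card.
  by rewrite cards1 -leqNgt.
by rewrite inE => yz ezy; exists y.
Qed.

(** Suppose an edge leaving [X] ends at [z]. An edge leaving [z |: X] either starts in [X], or joins
    [z] to some [w], which is then adjacent to the neighbour of [z] in [X]. *)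
Lemma conn_simplicialD1 e S z : symmetric e -> conn e S -> simplicial e S z ->
  1 < #|S| -> conn e (S :\ z).
Proof.
move=> es Sc [zS sz] S1; have /connP[_ H] := Sc; apply/connP; split.
  by rewrite -card_gt0; move: S1; rewrite (cardsD1 z) zS.
move=> X X0 /properP[XS [y0]]; rewrite !inE => /andP[y0z y0S] y0X.
have zX : z \notin X by apply/negP=> /(subsetP XS); rewrite !inE eqxx.
have XS' : X \subset S by apply: subset_trans XS (subD1set _ _).
have [|x [y [xX yS yX exy]]] := H X X0; first by apply/properP; split=> //; exists y0.
have [yz|yz] := eqVneq y z; last by exists x, y; rewrite !inE yz.
subst y.
have [||u [w [uX wS wX euw]]] := H (z |: X).
- by apply/set0Pn; exists z; rewrite !inE eqxx.
- apply/properP; split; first by rewrite subUset sub1set zS.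
  by exists y0; rewrite // !inE (negPf y0z).
move: wX; rewrite !inE negb_or => /andP[wz wX].
have ezw_x : e z w -> e x w.
  move=> ezw; apply: sz => //; [exact: subsetP xX | | by rewrite es].
  by apply: contraNneq wX => <-.
case/setU1P: uX => [uz|uX]; first by exists x, w; rewrite !inE wz wS ezw_x -?uz.
by exists u, w; rewrite !inE wz.
Qed.

(** The alternatives express through [e] that the contraction of [L] by [A] has a simplicial vertex
    [z] outside [A], or that the contracted vertex is itself simplicial. Induction on the size of
    [A]: a simplicial vertex of [L] lying in [A] is deleted from both sets, until [A] is a single
    vertex. *)
Lemma simplicial_contract e V A : symmetric e -> simplicial_hereditary e V ->
  conn e A -> forall L, A \subset L -> L \subset V ->
  (exists z, [/\ z \in L, z \notin A,
     forall x y, x \in L :\: A -> y \in L :\: A -> x != y -> e z x -> e z y -> e x y &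
     forall u x, u \in A -> x \in L :\: A -> x != z -> e z u -> e z x ->
       exists2 w, w \in A & e w x]) \/
  (forall u v x y, u \in A -> v \in A -> x \in L :\: A -> y \in L :\: A ->
     x != y -> e u x -> e v y -> e x y).
Proof.
move=> es sV; have [n] := ubnP #|A|; elim: n A => // n IHn A /ltnSE An Ac L AL LV.
have L0 : L != set0.
  by have [a aA] := set0Pn _ (conn_neq0 Ac); apply/set0Pn; exists a; apply: (subsetP AL).
have [z [zL sz]] := sV L LV L0.
case: (boolP (z \in A)) => zA; last first.
  left; exists z; split=> //.
    by move=> x y /setDP[xL _] /setDP[yL _]; apply: sz.
  move=> u x uA /setDP[xL xA] xz ezu ezx; exists u => //.
  by apply: sz; rewrite // ?(subsetP AL) //; apply: contraNneq xA => <-.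
have [A1|A1] := leqP #|A| 1.
  have AE : A = [set z].
    by apply/esym/eqP; rewrite eqEcard sub1set zA cards1.
  right=> u v x y; rewrite AE => /set1P-> /set1P-> /setDP[xL _] /setDP[yL _].
  exact: sz.
have [w [wA wz ezw]] := conn_nbr Ac zA A1.
(* The neighbour [w] of [z] in [A] sees every neighbour of [z] outside [A], so deleting [z] from [A]
   loses no outside neighbour. *)
have Adj x u : x \in L :\: A -> u \in A -> e u x -> exists2 u', u' \in A :\ z & e u' x.
  move=> /setDP[xL xA] uA eux; have [uz|uz] := eqVneq u z.
    exists w; first by rewrite !inE wz.
    by apply: sz; rewrite -?uz ?uz // ?(subsetP AL) //; [apply: contraNneq xA => <-|rewrite -uz].
  by exists u; rewrite // !inE uz.
have LA : (L :\ z) :\: (A :\ z) = L :\: A.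
  apply/setP=> x; rewrite !inE; case: (eqVneq x z) => [->|] //=.
  by rewrite zA.
have [||||[z' [z'L z'A H1 H2]]|H] := IHn (A :\ z) _ _ (L :\ z).
- by move: An; rewrite (cardsD1 z A) zA.
- apply: conn_simplicialD1 => //; split=> // x y xA yA.
  by apply: sz; apply: (subsetP AL).
- exact: setSD.
- exact: subset_trans (subD1set _ _) LV.
- move: z'L z'A; rewrite !inE => /andP[z'z z'L]; rewrite z'z /= => z'A.
  left; exists z'; split=> //; first by move=> x y; rewrite -LA; apply: H1.
  move=> u x uA xLA xz ezu ezx.
  have [u' u'A eu'] : exists2 u', u' \in A :\ z & e u' z'.
    by apply: (Adj z' u) => //; rewrite ?inE ?z'A // es.
  have [||w' w'A ew'] := H2 u' x u'A _ xz _ ezx; [by rewrite LA | by rewrite es|].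
  by exists w' => //; case/setD1P: w'A.
right=> u v x y uA vA xL yL xy eux evy.
have [u' u'A eu'] := Adj _ _ xL uA eux; have [v' v'A ev'] := Adj _ _ yL vA evy.
by apply: (H u' v'); rewrite ?LA.
Qed.

Lemma simplicial_hereditary_quot e V A a : symmetric e -> a \in A -> A \subset V ->
  conn e A -> simplicial_hereditary e V ->
  simplicial_hereditary (identify e A a) (quot A a V).
Proof.
move=> es aA AV Ac sV S SQ S0.
have inE' x : x \in S -> x != a -> (x \in V) && (x \notin A).
  by move=> xS; apply: quot_in => //; apply: (subsetP SQ).
have faA x : x != a -> fiber A a x = [set x] by rewrite /fiber => /negPf->.
have fa : fiber A a a = A by rewrite /fiber eqxx.
(* Away from the contracted vertex the identified graph agrees with [e]. *)
case: (boolP (a \in S)) => aS; last first.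
  have na x : x \in S -> x != a by move=> xS; apply: contraNneq aS => <-.
  have [||z [zS sz]] := sV S.
  - by apply/subsetP=> x xS; case/andP: (inE' x xS (na x xS)).
  - by [].
  exists z; split=> // x y xS yS xy.
  have [->|xz] := eqVneq z x; first by rewrite /identify /= eqxx.
  have [->|yz] := eqVneq z y; first by rewrite /identify /= eqxx.
  by rewrite !identifyE ?na //; apply: sz.
have Sa x : x \in S :\ a -> x \in (S :|: A) :\: A.
  by case/setD1P=> xa xS; rewrite !inE xS andbT; case/andP: (inE' x xS xa).
have SA x : x \in (S :|: A) :\: A -> x \in S /\ x != a.
  rewrite !inE => /andP[xA /orP[xS|]]; last by rewrite (negPf xA).
  by split=> //; apply: contraNneq xA => ->.
have [||[z [zL zA H1 H2]]|H] := simplicial_contract es sV Ac (L := S :|: A).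
- exact: subsetUr.
- rewrite subUset AV andbT; apply/subsetP=> x xS.
  have [->|xa] := eqVneq x a; first exact: (subsetP AV).
  by case/andP: (inE' x xS xa).
- have [zS za] : z \in S /\ z != a by apply: SA; rewrite inE zA.
  exists z; split=> //.
  (* The case of a pair of neighbours of [z] one of which is the contracted vertex; this is where
     [H2] enters. *)
  have key x : x \in S -> x != a -> identify e A a z a -> identify e A a z x ->
      identify e A a a x.
    move=> xS xa /identifyP[_ [u [v [+ vA euv]]]]; rewrite faA // => /set1P uz; subst u.
    move=> /identifyP[zx [u [w [+ + ezx]]]]; rewrite !faA // => /set1P uz /set1P wx.
    subst u w; rewrite fa in vA.
    have xL : x \in (S :|: A) :\: A by apply: Sa; rewrite !inE xa.
    rewrite eq_sym in zx; have [w wA ewx] := H2 v x vA xL zx euv ezx.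
    by apply/identifyP; split; [rewrite eq_sym | exists w, x; rewrite fa faA // inE eqxx].
  move=> x y xS yS xy.
  have [->|xz] := eqVneq z x; first by rewrite /identify /= eqxx.
  have [->|yz] := eqVneq z y; first by rewrite /identify /= eqxx.
  have [xa|xa] := eqVneq x a.
    by subst x => ea ey; apply: key => //; rewrite eq_sym.
  have [ya|ya] := eqVneq y a.
    by subst y => ex ea; rewrite identify_sym //; apply: key.
  by rewrite !identifyE //; apply: H1 => //; apply: Sa; rewrite !inE ?xa ?ya.
exists a; split=> // x y xS yS xy.
move=> /identifyP[ax [u [x' [+ + eux]]]]; rewrite eq_sym in ax.
rewrite fa faA // => uA /set1P xE; subst x'.
move=> /identifyP[ay [v [y' [+ + evy]]]]; rewrite eq_sym in ay.
rewrite fa faA // => vA /set1P yE; subst y'.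
by rewrite identifyE //; apply: (H u v) => //; apply: Sa; rewrite !inE ?ax ?ay.
Qed.

End Connectivity.

(** * Chordal graphs have simplicial vertices *)

Section Chordal.
Variable T : finType.
Implicit Types (e r : rel T) (v x y z : T) (A B C L S V X : {set T}).

Lemma shortest_path r x y : connect r x y ->
  exists p, [/\ path r x p, last x p = y &
    forall q, path r x q -> last x q = y -> size p <= size q].
Proof.
move=> /connectP[p0 p0p p0y].
pose P n := [exists p : n.-tuple T, path r x p && (last x p == y)].
have exP : exists n, P n.
  by exists (size p0); apply/existsP; exists (in_tuple p0); rewrite /= p0p p0y eqxx.
case: (ex_minnP exP) => n /existsP[p /andP[pp /eqP py]] minn.
exists p; split=> // q qp qy; rewrite size_tuple; apply: minn.
by apply/existsP; exists (in_tuple q); rewrite /= qp qy eqxx.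
Qed.

(** A repeated vertex, or a chord with [i.+1 < j], lets the piece between positions [i] and [j] be
    cut out, against minimality. *)
Lemma shortest_path_chordless r x p :
  path r x p ->
  (forall q, path r x q -> last x q = last x p -> size p <= size q) ->
  uniq (x :: p) /\
  forall i j, i < j -> j <= size p ->
    r (nth x (x :: p) i) (nth x (x :: p) j) -> j = i.+1.
Proof.
move=> pp minp.
have last_take i : i <= size p -> last x (take i p) = nth x (x :: p) i.
  move=> ip; rewrite (last_nth x) size_takel //.
  by case: i ip => [|i] ip //=; rewrite nth_take.
have split_path i : path r x (take i p) /\ path r (last x (take i p)) (drop i p).
  by apply/andP; rewrite -cat_path cat_take_drop.
have last_drop i : last (last x (take i p)) (drop i p) = last x p.
  by rewrite -last_cat cat_take_drop.
split.
  apply/(uniqPn x) => -[i [j [ij jp eq_ij]]]; rewrite /= ltnS in jp.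
  have ip : i <= size p by lia.
  have := minp (take i p ++ drop j p).
  have [p1 _] := split_path i; have [_ p2] := split_path j.
  rewrite cat_path last_cat size_cat size_takel // size_drop p1 /=.
  rewrite last_take // eq_ij -last_take // p2 last_drop => /(_ isT erefl).
  by lia.
move=> i j ij jp rij; have ip : i <= size p by lia.
have := minp (take i p ++ nth x (x :: p) j :: drop j p).
have [p1 _] := split_path i; have [_ p2] := split_path j.
rewrite cat_path last_cat size_cat size_takel //= size_drop p1 /=.
rewrite [last x (take i p)]last_take // rij /= -(last_take j) // p2 last_drop.
by move=> /(_ isT erefl); lia.
Qed.

Lemma next_cons v s u : u \in s -> v != u ->
  next (v :: s) u = nth v s (index u s).+1.
Proof. by move=> us nv; rewrite next_nth inE us orbT /= (negPf nv). Qed.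

(* Otherwise a shortest path from [x] to [y] through [C], closed up by [v],
   would be an induced cycle of length at least 4. *)
Lemma chordal_nbrs e v C x y :
  symmetric e -> irreflexive e -> chordal e -> conn e C -> v \notin C ->
  (forall c, c \in C -> ~~ e v c) -> e v x -> e v y -> x != y ->
  (exists2 c, c \in C & e x c) -> (exists2 c, c \in C & e y c) -> e x y.
Proof.
move=> es ei ch Cc vC nvC evx evy xy [c cC exc] [d dC eyd].
apply: contraT => nxy.
(* Confining the path to [C] and its two ends ensures that [x] and [y] are the only neighbours of
   [v] on it. *)
pose D := x |: (y |: C); pose r := induced e D.
have CD : C \subset D by rewrite /D setUA subsetUr.
have cD : c \in D := subsetP CD c cC; have dD : d \in D := subsetP CD d dC.
have xD : x \in D by rewrite !inE eqxx.
have yD : y \in D by rewrite !inE eqxx orbT.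
have rxy : connect r x y.
  apply: (@connect_trans _ _ c); first by apply: connect1; apply/and3P.
  apply: (@connect_trans _ _ d).
    have C0 := conn_neq0 Cc; rewrite conn_connected_block // in Cc.
    have := forall_inP (forall_inP Cc c cC) d dC; apply: connect_sub => u w.
    by move=> /and3P[uC wC euw]; apply: connect1; apply/and3P; split; rewrite ?(subsetP CD).
  by apply: connect1; apply/and3P; rewrite es.
have [p [pp py pmin]] := shortest_path rxy.
have [|us chl] := shortest_path_chordless pp.
  by move=> q qp; rewrite py; apply: pmin.
have sub_e : subrel r e by move=> u w /and3P[].
have path_in q z u : path r z q -> u \in q -> u \in D.
  elim: q z => //= w q IHq z /andP[/and3P[_ wD _] wq].
  by rewrite inE => /predU1P[->//|]; apply: IHq wq.
have pD u : u \in x :: p -> u \in D.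
  by rewrite inE => /predU1P[->//|]; exact: path_in pp.
have p2 : 1 < size p.
  case: p pp py {pmin us chl pD} => [_ /= E|w [|//]]; first by rewrite E eqxx in xy.
  by move=> /= /andP[/and3P[_ _ exw] _] E; rewrite -E exw in nxy.
have nev u : e v u -> u \in x :: p -> u = x \/ u = y.
  move=> evu /pD; rewrite !inE => /or3P[/eqP|/eqP|/nvC]; [by left|by right|].
  by rewrite evu.
have vD : v \notin D.
  rewrite !inE !negb_or vC andbT; apply/andP; split.
    by apply: contraTneq evx => ->; rewrite ei.
  by apply: contraTneq evy => ->; rewrite ei.
have vp : v \notin x :: p by apply: contra vD; apply: pD.
have uc : uniq (v :: x :: p) by rewrite cons_uniq vp.
have nxt i : i < size p ->
    next (v :: x :: p) (nth x (x :: p) i) = nth x (x :: p) i.+1.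
  move=> ip; have ip' : i < size (x :: p) by rewrite /= ltnS ltnW.
  rewrite next_cons ?mem_nth ?index_uniq //; first exact: set_nth_default.
  by apply: contraNneq vp => ->; apply: mem_nth.
have nxt_v : next (v :: x :: p) v = x by rewrite /= eqxx.
have nxt_y : next (v :: x :: p) y = v.
  have yE : y = nth x (x :: p) (size p) by rewrite -py -last_nth.
  rewrite next_cons; first by rewrite {1}yE index_uniq // nth_default.
    by rewrite yE mem_nth.
  by apply: contraNneq vD => ->.
(* The path has at least two edges because [x] and [y] are not adjacent, so closing it up by [v]
   gives at least four vertices. *)
suff : size (v :: x :: p) <= 3 by rewrite /= !ltnS leqNgt p2.
apply: ch; split.
- by rewrite /= !ltnS ltnW.
- rewrite /ucycle uc andbT /= rcons_path evx py es evy andbT.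
  exact: sub_path pp.
have main u w : u \in x :: p -> w \in x :: p -> e u w ->
    index u (x :: p) < index w (x :: p) -> w = next (v :: x :: p) u.
  move=> us' ws euw lt.
  have wi : index w (x :: p) <= size p by rewrite -ltnS -/(size (x :: p)) index_mem.
  have := chl _ _ lt wi; rewrite !nth_index // => /(_ _)E.
  have {}E : index w (x :: p) = (index u (x :: p)).+1.
    by apply: E; apply/and3P; rewrite !pD.
  have ui : index u (x :: p) < size p by rewrite E in wi.
  by have := nxt _ ui; rewrite -E !nth_index.
move=> u w; rewrite 2!(in_cons v).
case/predU1P=> [->|us'] /predU1P[->|ws] euw.
- by rewrite ei in euw.
- case: (nev w euw ws) => ->; first by left.
  by right.
- rewrite es in euw; case: (nev u euw us') => ->; last by left.
  by right.
have [lt|lt|E] := ltngtP (index u (x :: p)) (index w (x :: p)).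
- by left; apply: main.
- by right; apply: main; rewrite // es.
have uw : u = w by rewrite -(nth_index x us') E nth_index.
by rewrite uw ei in euw.
Qed.

Definition component e X u : {set T} := [set w in X | connect (induced e X) u w].

Lemma component_closed e X u w z :
  w \in component e X u -> z \in X -> e w z -> z \in component e X u.
Proof.
rewrite !inE => /andP[wX uw] zX ewz; rewrite zX /=.
by apply: connect_trans uw (connect1 _); apply/and3P.
Qed.

Lemma component_id e X u : u \in X -> u \in component e X u.
Proof. by rewrite inE connect0 andbT. Qed.

Lemma conn_component e X u : symmetric e -> u \in X -> conn e (component e X u).
Proof.
move=> es uX; have uC := component_id e uX.
rewrite conn_connected_block; last by apply/set0Pn; exists u.
set C := component e X u in uC *.
have stay p : forall y, y \in C -> path (induced e X) y p ->
    connect (induced e C) y (last y p).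
  elim: p => [|z p IHp] y yC //= /andP[/and3P[yX zX eyz] zp].
  have zC := component_closed yC zX eyz.
  by apply: connect_trans (connect1 _) (IHp z zC zp); apply/and3P.
have toC w : w \in C -> connect (induced e C) u w.
  by rewrite inE => /andP[_ /connectP[p up ->]]; apply: stay.
have cs : connect_sym (induced e C).
  by apply: sym_connect_sym => x y; rewrite /induced /= es andbCA.
apply/forall_inP=> x xC; apply/forall_inP=> y yC.
by apply: connect_trans (toC y yC); rewrite cs toC.
Qed.

(* Dirac's argument: if [v] is not universal in [S], let [C] be a component of
   the non-neighbours of [v]; its boundary [B] is a clique, and a simplicial
   vertex of [C :|: B] lying in [C] is simplicial in [S]. *)
Lemma chordal_simplicial_avoiding e S v :
  symmetric e -> irreflexive e -> chordal e -> v \in S ->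
  (forall u, u \in S -> u != v -> e v u) \/
  (exists z, [/\ simplicial e S z, z != v & ~~ e v z]).
Proof.
move=> es ei ch; have [n] := ubnP #|S|; elim: n S v => // n IHn S v /ltnSE Sn vS.
case: (boolP [forall u in S, (u != v) ==> e v u]).
  by move=> /forall_inP univ; left=> u uS uv; apply: (implyP (univ u uS)).
rewrite negb_forall_in => /exists_inP[u uS]; rewrite negb_imply => /andP[uv nvu].
right; pose X := [set w in S | (w != v) && ~~ e v w].
have uX : u \in X by rewrite inE uS uv.
pose C := component e X u.
have uC : u \in C := component_id e uX; have Cc : conn e C := conn_component es uX.
have CX : C \subset X by apply/subsetP=> w; rewrite inE => /andP[].
have CX' w : w \in C -> [/\ w \in S, w != v & ~~ e v w].
  by move/(subsetP CX); rewrite inE => /and3P[].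
have vC : v \notin C by apply/negP=> /CX'[_ /eqP].
pose B := [set b in S :\: C | [exists c in C, e c b]].
have BP b : b \in B -> [/\ b \in S, b \notin C, e v b & exists2 c, c \in C & e b c].
  rewrite [b \in B]inE => /andP[/setDP[bS bC] /exists_inP[c cC ecb]].
  split=> //; last by exists c; rewrite // es.
  have [_ cv nvc] := CX' c cC.
  have [bv|bv] := eqVneq b v; first by rewrite -bv es ecb in nvc.
  by apply: contraT => nvb; rewrite (component_closed cC _ ecb) // inE bS bv in bC.
have Bclique x y : x \in B -> y \in B -> x != y -> e x y.
  move=> /BP[_ _ evx xC] /BP[_ _ evy yC] xy; apply: (chordal_nbrs (v := v) (C := C)) => //.
  by move=> c /CX'[].
pose D := C :|: B.
have DS w : w \in D -> w \in S by case/setUP=> [/CX'[]|/BP[]].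
have vD : v \notin D.
  rewrite inE negb_or vC; apply/negP=> /BP[_ _]; by rewrite ei.
have Dn : #|D| < n.
  apply: leq_trans Sn; apply: proper_card; apply/properP.
  by split; [apply/subsetP | exists v].
have lift z : simplicial e D z -> z \in C -> exists z, [/\ simplicial e S z, z != v & ~~ e v z].
  move=> [_ sz] zC; have [zS zv nvz] := CX' z zC; exists z; split=> //; split=> //.
  have toD x : x \in S -> e z x -> x \in D.
    move=> xS ezx; rewrite inE; case xC: (x \in C) => //=.
    by rewrite inE in_setD xC xS; apply/exists_inP; exists z.
  by move=> x y xS yS xy ezx ezy; apply: sz => //; apply: toD.
(* Induction at a vertex [b] of [B] that is not universal in [D] returns a simplicial vertex not
   adjacent to [b]; as [B] is a clique, this vertex lies in [C]. *)
case: (boolP [exists b in B, [exists w in D, (w != b) && ~~ e b w]]).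
  case/exists_inP=> b bB /exists_inP[w wD /andP[wb nbw]].
  have bD : b \in D by rewrite inE bB orbT.
  case: (IHn D b Dn bD) => [univ|[z [sz zb nbz]]]; first by rewrite univ in nbw.
  have [zD _] := sz; apply: (lift z sz); case/setUP: zD => // zB.
  by rewrite Bclique // eq_sym in nbz.
move=> noB; have Buniv b w : b \in B -> w \in D -> w != b -> e b w.
  move=> bB wD wb; apply: contraNT noB => nbw; apply/exists_inP; exists b => //.
  by apply/exists_inP; exists w; rewrite // wb.
(* Every vertex of [B] is now universal in [D], so a simplicial vertex not adjacent to [c] again
   lies in [C]. *)
case: (boolP [exists c in C, [exists w in D, (w != c) && ~~ e c w]]).
  case/exists_inP=> c cC /exists_inP[w wD /andP[wc ncw]].
  have cD : c \in D by rewrite inE cC.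
  case: (IHn D c Dn cD) => [univ|[z [sz zc ncz]]]; first by rewrite univ in ncw.
  have [zD _] := sz; apply: (lift z sz); case/setUP: zD => // zB.
  by rewrite es Buniv // eq_sym in ncz.
(* What remains is the case where [D] is a clique. *)
move=> noC; apply: (lift u) => //; split; first by rewrite inE uC.
move=> x y xD yD xy _ _; case/setUP: (xD) => [xC|xB]; last by rewrite Buniv // eq_sym.
apply: contraNT noC => nxy; apply/exists_inP; exists x => //.
by apply/exists_inP; exists y; rewrite // eq_sym xy.
Qed.

Lemma chordal_simplicial_hereditary e V :
  symmetric e -> irreflexive e -> chordal e -> simplicial_hereditary e V.
Proof.
move=> es ei ch S _ /set0Pn[v vS].
case: (boolP [exists w in S, [exists u in S, (u != w) && ~~ e w u]]).
  case/exists_inP=> w wS /exists_inP[u uS /andP[uw nwu]].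
  have [univ|[z [sz _ _]]] := chordal_simplicial_avoiding es ei ch wS; last by exists z.
  by rewrite univ in nwu.
move=> noS; exists v; split=> // x y xS yS xy _ _; apply: contraNT noS => nxy.
apply/exists_inP; exists x => //; apply/exists_inP; exists y => //.
by rewrite eq_sym xy.
Qed.

End Chordal.

Local Open Scope ring_scope.

(** * Sums over partitions and the block polynomials *)

Section PartitionSums.
Variables (T : finType) (R : comNzRingType).
Implicit Types (F : {set T} -> R) (S B : {set T}).

Definition psum F S : R := \sum_(P | partition P S) \prod_(B in P) F B.

Lemma psum0 F : psum F set0 = 1.
Proof.
rewrite /psum (big_pred1 set0) ?big_set0 // => P.
exact: partition_set0.
Qed.

(** Partitions of [S] are sorted by the block [B] containing [a]; adding [B] is a bijection from the
    partitions of the remainder. *)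
Lemma psum_peel F S a : a \in S ->
  psum F S = \sum_(B : {set T} | (a \in B) && (B \subset S)) F B * psum F (S :\: B).
Proof.
move=> aS; rewrite /psum.
rewrite (partition_big (fun P => pblock P a)
   (fun B : {set T} => (a \in B) && (B \subset S))) /=; last first.
  move=> P partP; have aP : a \in cover P by rewrite (cover_partition partP).
  by rewrite mem_pblock aP (partitionS partP) // pblock_mem.
apply: eq_bigr => B /andP[aB BS]; rewrite big_distrr /=.
have BnP P' : partition P' (S :\: B) -> B \notin P'.
  move=> partP'; apply/negP=> /(partitionS partP')/subsetP/(_ a aB).
  by rewrite inE aB.
rewrite (reindex_onto (fun P' => B |: P') (fun P => P :\ B)) /=; last first.
  move=> P /andP[partP /eqP <-]; apply: setD1K; rewrite pblock_mem //.
  by rewrite (cover_partition partP).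
apply: eq_big => [P'|P' /andP[/andP[partP _] /eqP P'E]].
  apply/idP/idP => [/andP[/andP[partP _] /eqP <-]|partP'].
    by apply: partitionD1 => //; rewrite setU11.
  have partP : partition (B |: P') S.
    have SE : B :|: S :\: B = S by rewrite -[RHS](setID S B) (setIidPr BS).
    rewrite -[X in partition _ X]SE.
    apply: partitionU1 => //; first by apply/set0Pn; exists a.
    by rewrite disjoint_sym disjoints_subset setDE subsetIr.
  rewrite partP setU1K ?BnP // eqxx andbT /=.
  by apply/eqP/def_pblock; rewrite ?setU11 ?(partition_trivIset partP).
rewrite big_setU1 // -P'E.
by rewrite !inE eqxx.
Qed.

Lemma eq_psum F F' S :
  (forall B, B \subset S -> F B = F' B) -> psum F S = psum F' S.
Proof.
move=> FF; apply: eq_bigr => P partP; apply: eq_bigr => B BP.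
by rewrite FF // (partitionS partP).
Qed.

Lemma psum1 F a : psum F [set a] = F [set a].
Proof.
rewrite (psum_peel _ (set11 a)) (big_pred1 [set a]).
  by rewrite setDv psum0 mulr1.
move=> B /=; rewrite subset1 -sub1set.
by apply/andP/eqP => [[aB /orP[/eqP//|/eqP B0]]|->];
  [rewrite B0 subset0 -cards_eq0 cards1 in aB | rewrite subxx eqxx].
Qed.

Lemma psum_scale q F S :
  psum (fun B => q * F B) S =
  \sum_(P | partition P S) q ^+ #|P| * \prod_(B in P) F B.
Proof. by apply: eq_bigr => P _; rewrite big_split prodr_const. Qed.

End PartitionSums.

Section BlockPolynomials.
Variable T : finType.
Implicit Types (e : rel T) (A B C S V X : {set T}) (P : {set {set T}}).

(** The t-integer of [l], which enumerates the possible excesses 0, ..., l - 1 of the weight of a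
    block over the total weight of its [l] parts. *)
Definition qint (l : nat) : {poly int} := \sum_(i < l) 'X^i.

Lemma qintE l : (1 - 'X) * qint l = 1 - 'X^l.
Proof.
rewrite -[1 in RHS](expr1n _ l) subrXX.
by under [in RHS]eq_bigr do rewrite expr1n mul1r.
Qed.

Lemma size_qint l : (size (qint l) <= l)%N.
Proof.
by apply: (leq_trans (size_sum _ _ _)); apply/bigmax_leqP => i _; rewrite size_polyXn.
Qed.

Lemma subr1X_neq0 : 1 - 'X != 0 :> {poly int}.
Proof.
by apply/eqP=> /(congr1 (fun p : {poly int} => p.[0])); rewrite !hornerE.
Qed.

(** The first argument is fuel. Disconnected sets get the value 0, so that sums may run over all set
    partitions instead of the bond partitions. *)
Fixpoint bpoly_rec m e B : {poly int} :=
  if m is m'.+1 then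
    if ~~ conn e B then 0 else if #|B| == 1%N then 1 else
    - \sum_(P | partition P B && (P != [set B]))
        qint #|P| * \prod_(C in P) bpoly_rec m' e C
  else 0.

(* The coefficient of ['X^v] in [bpoly e B] is the Moebius value of the
   interval from the minimum to the weighted block [B^v], see [mobius_wbond]. *)
Definition bpoly e B : {poly int} := bpoly_rec #|B| e B.

Lemma partition_block_lt P B C :
  partition P B -> P != [set B] -> C \in P -> (#|C| < #|B|)%N.
Proof.
move=> partP PB CP; apply: proper_card; rewrite properEneq (partitionS partP) // andbT.
apply: contraNneq PB => CB; rewrite eqEsubset sub1set -CB CP andbT.
apply/subsetP=> D DP; rewrite inE; apply: contraT => DC.
have [x xD] := set0Pn _ (partition_neq0 partP DP).
have xC : x \in C by rewrite CB (subsetP (partitionS partP DP)).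
have /trivIsetP/(_ D C DP CP DC)/disjointFr/(_ xD) := partition_trivIset partP.
by rewrite xC.
Qed.

Lemma bpoly_recE m e B : (#|B| <= m)%N -> bpoly_rec m e B = bpoly e B.
Proof.
rewrite /bpoly; elim: m {-2}m (leqnn m) B => [|k IHk] m mk B Bm.
  by move: Bm; case: m mk => // _; rewrite leqn0 => /eqP->.
case: m mk Bm => [|m] mk Bm; first by move: Bm; rewrite leqn0 => /eqP->.
case EB: #|B| Bm => [|b] Bm.
  by move/eqP: EB; rewrite cards_eq0 => /eqP->; rewrite /= /conn eqxx.
rewrite /= EB; case: ifP => // _; case: ifP => // _; congr (- _).
apply: eq_bigr => P /andP[partP PB]; congr (_ * _); apply: eq_bigr => C CP.
have := partition_block_lt partP PB CP; rewrite EB ltnS => Cb.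
have Cm := leq_trans Cb Bm; rewrite (IHk m mk C Cm).
by rewrite (IHk b (leq_trans Bm mk) C Cb).
Qed.

Lemma bpoly_nconn e B : ~~ conn e B -> bpoly e B = 0.
Proof. by move=> nB; rewrite /bpoly; case: #|B| => //= n; rewrite nB. Qed.

Lemma bpoly1 e a : bpoly e [set a] = 1.
Proof. by rewrite /bpoly cards1 /= conn1 cards1. Qed.

Lemma bpoly_rel e B : conn e B -> (1 < #|B|)%N ->
  \sum_(P | partition P B) qint #|P| * \prod_(C in P) bpoly e C = 0.
Proof.
move=> Bc B1; have B0 := conn_neq0 Bc.
have partB : partition [set B] B.
  apply/and3P; split; rewrite ?trivIset1 //; first by rewrite /cover big_set1.
  by rewrite inE eq_sym.
rewrite (bigD1 [set B]) //= cards1 big_set1 /qint big_ord_recl big_ord0 addr0 mul1r.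
rewrite -[X in X + _](@bpoly_recE #|B|.+1) /= ?Bc ?gtn_eqF //=.
apply/eqP; rewrite addrC subr_eq0; apply/eqP; apply: eq_bigr => P /andP[partP PB].
congr (_ * _); apply: eq_bigr => C CP; rewrite bpoly_recE //.
by rewrite ltnW // (partition_block_lt partP).
Qed.

(** For a partition into l blocks, the block polynomials contribute degree at most |B| - l and
    [qint l] at most l - 1. This matches the bound on the weight of a block. *)
Lemma size_bpoly e B : (size (bpoly e B) <= #|B|)%N.
Proof.
have [n] := ubnP #|B|; elim: n B => // n IHn B /ltnSE Bn.
case: (boolP (conn e B)) => Bc; last by rewrite bpoly_nconn // size_poly0.
rewrite -(@bpoly_recE #|B|.+1) /= ?Bc //=.
case: eqP => [->|_]; first by rewrite size_poly1.
rewrite size_polyN; apply: (leq_trans (size_sum _ _ _)).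
apply/bigmax_leqP => P /andP[partP PB].
apply: (leq_trans (size_polyMleq _ _)).
have := size_qint #|P|.
have: (size (\prod_(C in P) bpoly_rec #|B| e C)%R
         <= (\sum_(C in P) #|C|).+1 - #|P|)%N.
  apply: (leq_trans (size_prod_leq _ _)); apply: leq_sub2r; rewrite ltnS.
  apply: leq_sum => C CP; have CB := partition_block_lt partP PB CP.
  by rewrite bpoly_recE ?IHn ?(leq_trans CB) // ltnW.
have: (#|P| <= \sum_(C in P) #|C|)%N.
  by rewrite -sum1_card; apply: leq_sum => C CP; rewrite card_gt0 (partition_neq0 partP).
rewrite -(card_partition partP).
suff arith s1 s2 b p : (p <= b -> s2 <= b.+1 - p -> s1 <= p -> (s1 + s2).-1 <= b)%N.
  exact: arith.
by lia.
Qed.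

Lemma eq_bpoly e e' B :
  {in B &, forall x y, x != y -> e x y = e' x y} -> bpoly e B = bpoly e' B.
Proof.
rewrite /bpoly; move: #|B| => m; elim: m B => //= m IHm B ee.
rewrite (eq_conn ee); case: ifP => // _; case: ifP => // _; congr (- _).
apply: eq_bigr => P /andP[partP _]; congr (_ * _); apply: eq_bigr => C CP.
apply: IHm => x y xC yC; have CB := partitionS partP CP.
by apply: ee; apply: (subsetP CB).
Qed.

(** This is P_S(q): the parameter [q] marks the number of blocks. *)
Definition bsum (q : {poly int}) e S := psum (fun B => q * bpoly e B) S.

Lemma eq_bsum q e e' S :
  {in S &, forall x y, x != y -> e x y = e' x y} -> bsum q e S = bsum q e' S.
Proof.
move=> ee; apply: eq_psum => B BS; congr (_ * _); apply: eq_bpoly => x y xB yB.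
by apply: ee; apply: (subsetP BS).
Qed.

(** Multiplying by [1 - 'X] turns [qint l] into [1 - 'X^l], and the power of ['X] is absorbed as one
    factor per block. The relation [bpoly_rel] thereby becomes P_S(1) = P_S(t). *)
Lemma qint_sum e S :
  (1 - 'X) * (\sum_(P | partition P S) qint #|P| * \prod_(C in P) bpoly e C) =
  bsum 1 e S - bsum 'X e S.
Proof.
rewrite /bsum !psum_scale -sumrB big_distrr /=.
by apply: eq_bigr => P _; rewrite -mulrBl expr1n mulrA qintE.
Qed.

Lemma bsum_conn e S : conn e S -> (1 < #|S|)%N -> bsum 'X e S = bsum 1 e S.
Proof.
move=> Sc S1; apply/esym/eqP; rewrite -subr_eq0 -qint_sum bpoly_rel //.
by rewrite mulr0.
Qed.

Lemma bsum1 q e a : bsum q e [set a] = q.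
Proof. by rewrite /bsum psum1 bpoly1 mulr1. Qed.

Lemma bsum0 q e : bsum q e set0 = 1.
Proof. exact: psum0. Qed.

(** On the right, peel off the block containing [a]: it is [quot A a C] for a unique [C] containing
    [A]. The other blocks avoid [a], where the two graphs agree. *)
Lemma bsum_quot q e A a S : symmetric e -> conn e A -> a \in A -> A \subset S ->
  \sum_(C : {set T} | [&& A \subset C, C \subset S & conn e C])
     q * bpoly (identify e A a) (quot A a C) * bsum q e (S :\: C) =
  bsum q (identify e A a) (quot A a S).
Proof.
move=> es Ac aA AS; have aS : a \in quot A a S by rewrite !inE eqxx.
have quotK X : a \in X -> X \subset quot A a S -> quot A a (X :|: A) = X.
  move=> aX XS; apply/setP=> x; rewrite !inE.
  have [->|xa] /= := eqVneq x a; first by rewrite aX.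
  case xX: (x \in X) => /=; last by rewrite andNb.
  by have /andP[_ ->] := quot_in aA (subsetP XS x xX) xa.
rewrite [RHS](psum_peel _ aS).
(* If [X :|: A] is disconnected then so is [X] in the quotient, and its block polynomial
   vanishes. *)
rewrite [RHS](bigID (fun X => conn e (X :|: A))) /= [X in _ = _ + X]big1 ?addr0; last first.
  move=> X /andP[/andP[aX XS] ncX]; rewrite bpoly_nconn ?mulr0 ?mul0r //.
  apply: contra ncX => cX; apply: (@conn_unquot _ e A a) => //; first exact: subsetUr.
  by rewrite quotK.
rewrite [RHS](reindex_onto (quot A a) (fun X => X :|: A)) /=; last first.
  by move=> X /andP[/andP[aX XS] _]; apply: quotK.
have qK C : (quot A a C :|: A == C) = (A \subset C).
  apply/eqP/idP => [<-|AC]; first exact: subsetUr.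
  apply/setP=> x; rewrite !inE; have [->|xa] /= := eqVneq x a; first by rewrite (subsetP AC).
  by case xA: (x \in A); rewrite ?orbF //= (subsetP AC).
apply: eq_big => [C|C /and3P[AC CS Cc]].
  rewrite qK; case AC: (A \subset C); rewrite ?andbF //= andbT.
  have /eqP-> : quot A a C :|: A == C by rewrite qK.
  rewrite !inE eqxx /=; congr (_ && _).
  apply/idP/idP => [CS|/subsetP CS]; first by apply: setUS; apply: setSD.
  apply/subsetP=> x xC; case xA: (x \in A); first exact: (subsetP AS).
  have xa : x != a by apply: contraFneq xA => ->.
  by have := CS x; rewrite !inE (negPf xa) xA xC /=; apply.
congr (_ * _); have -> : quot A a S :\: quot A a C = S :\: C.
  apply/setP=> x; rewrite !inE; have [->|xa] /= := eqVneq x a.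
    by rewrite (subsetP AC).
  by case xA: (x \in A); rewrite ?andbF //= (subsetP AC) // xA.
apply: eq_bsum => x y; have na z : z \in S :\: C -> z != a.
  by case/setDP=> _; apply: contraNneq => ->; apply: (subsetP AC).
by move=> /na xa /na ya xy; rewrite identifyE.
Qed.

End BlockPolynomials.

(** * The recursion at a simplicial vertex *)

(** The scalar [c] may fail to be a unit, so no inverse matrix is available; the adjugate and
    cancellation of the nonzero determinant replace it. *)
Lemma incidence_inverse (R : idomainType) (I : finType) (G : {set I})
    (X Y : I -> I -> R) (c : R) :
  c != 0 ->
  (forall i j, i \in G -> j \in G ->
     \sum_(k in G) X i k * Y k j = if i == j then c else 0) ->
  forall i j, i \in G -> j \in G ->
     \sum_(k in G) Y i k * X k j = if i == j then c else 0.
Proof.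
move=> c0 XY; pose mx Z := \matrix_(i < #|G|, j < #|G|) (Z (enum_val i) (enum_val j) : R).
have mxM Z W i j : (mx Z *m mx W) i j = \sum_(k in G) Z (enum_val i) k * W k (enum_val j).
  by rewrite mxE [RHS]big_enum_val; apply: eq_bigr => k _; rewrite !mxE.
have XYm : mx X *m mx Y = c%:M.
  apply/matrixP=> i j; rewrite mxM XY ?enum_valP // mxE (inj_eq enum_val_inj).
  by case: eqP; rewrite ?mulr1n ?mulr0n.
have det0 : \det (mx X) != 0.
  apply: contraNneq (expf_neq0 #|G| c0) => d0.
  by rewrite -det_scalar -XYm det_mulmx d0 mul0r.
(* Write the determinant as adj(X) X; then adj(X) (X Y) X = c adj(X) X. *)
have YXm : \det (mx X) *: (mx Y *m mx X) = \det (mx X) *: c%:M.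
  rewrite -mul_scalar_mx -mul_adj_mx -mulmxA (mulmxA (mx X)) XYm mul_scalar_mx.
  by rewrite -scalemxAr mul_adj_mx !scale_scalar_mx mulrC.
move=> i j iG jG; pose i' := enum_rank_in iG i; pose j' := enum_rank_in iG j.
move/matrixP/(_ i' j'): YXm; rewrite [LHS]mxE [RHS]mxE => /(mulfI det0).
rewrite mxM !enum_rankK_in // => ->; rewrite mxE.
have -> : (i' == j') = (i == j).
  apply/eqP/eqP => [ij|ij]; last by apply: enum_val_inj; rewrite !enum_rankK_in.
  by rewrite -(enum_rankK_in iG iG) -(enum_rankK_in iG jG) -/i' ij.
by case: eqP; rewrite ?mulr1n ?mulr0n.
Qed.

Section Recursion.
Variables (T : finType) (e : rel T) (V : {set T}) (a : T).
Hypotheses (esym : symmetric e) (Vc : conn e V) (aV : a \in V).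
Implicit Types (A B C : {set T}).

Let G := [set C : {set T} | [&& a \in C, C \subset V & conn e C]].

Let GP C : reflect [/\ a \in C, C \subset V & conn e C] (C \in G).
Proof. by rewrite inE; apply: and3P. Qed.

Let X A B := if A \subset B then bpoly (identify e A a) (quot A a B) else 0.
Let Z q A B := if A \subset B then bsum q e (B :\: A) else 0.

(** [bsum_quot] in matrix form; the extra factor [q] belongs to the block containing the contracted
    vertex. *)
Let XZ q A B : A \in G -> B \in G ->
  \sum_(C in G) X A C * (q * Z q C B) =
  if A \subset B then bsum q (identify e A a) (quot A a B) else 0.
Proof.
move=> /GP[aA AV Ac] /GP[aB BV Bc]; case: ifP => AB; last first.
  apply: big1 => C _; rewrite /X /Z; case: ifP => AC; rewrite ?mul0r //.
  by case: ifP => CB; rewrite ?mulr0 //; rewrite (subset_trans AC CB) in AB.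
rewrite -bsum_quot // [RHS]big_mkcond /= [LHS]big_mkcond /=.
apply: eq_bigr => C _; rewrite /X /Z inE.
case: (boolP (A \subset C)) => AC /=; last by rewrite !mul0r if_same.
case: (boolP (C \subset B)) => CB /=; last by rewrite !mulr0 if_same.
rewrite (subsetP AC) // (subset_trans CB BV) /=.
by case: ifP => // _; rewrite mulrCA mulrA.
Qed.

Let Y A B := Z 1 A B - 'X * Z 'X A B.

(** By [XZ], the entry of X Y at a strict inclusion is P(1) - P(t) for a connected quotient with at
    least two vertices, hence 0; on the diagonal the quotient is one vertex and gives 1 - t. Then
    the factors are swapped. *)
Let YX A B : A \in G -> B \in G ->
  \sum_(C in G) Y A C * X C B = if A == B then 1 - 'X else 0.
Proof.
apply: incidence_inverse => {A B} [|A B AG BG]; first exact: subr1X_neq0.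
under eq_bigr do rewrite mulrBr -{1}[Z 1 _ _]mul1r.
rewrite sumrB !XZ //; have /GP[aA AV Ac] := AG; have /GP[aB BV Bc] := BG.
have [<-|AB] := eqVneq A B; first by rewrite subxx quot_id !bsum1.
case: ifP => sAB; last by rewrite subrr.
have Qc := conn_quot esym aA sAB Bc.
rewrite bsum_conn ?subrr //.
rewrite -(ltn_add2r #|A|) card_quot // add1n ltnS.
by apply: proper_card; rewrite properEneq AB.
Qed.

(* The recursions below are the entries at [([set a], V)] of [Y X = (1 - 'X) I]
   and of [Y (X Z) = (1 - 'X) Z]. *)
Let aG : [set a] \in G.
Proof. by rewrite inE set11 sub1set aV conn1. Qed.

Let VG : V \in G.
Proof. by rewrite inE aV subxx Vc. Qed.

(** For [C] containing [a], [bterm (C :\ a)] is the entry of [Y] at [[set a]] and [C]. *)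
Definition bterm H : {poly int} := bsum 1 e H - 'X * bsum 'X e H.

Lemma bpoly_contract : (1 < #|V|)%N ->
  \sum_(C : {set T} | [&& a \in C, C \subset V & conn e C])
     bterm (C :\ a) * bpoly (identify e C a) (quot C a V) = 0.
Proof.
move=> V1; have := YX aG VG; rewrite [_ == V]negbTE; last first.
  by apply: contraTneq V1 => <-; rewrite cards1.
apply: etrans; apply: eq_big => [C|C /and3P[aC CV _]]; first by rewrite inE.
by rewrite /X /Y /Z CV sub1set aC.
Qed.

Lemma bsum_contract :
  \sum_(C : {set T} | [&& a \in C, C \subset V & conn e C])
     bterm (C :\ a) * bsum 1 (identify e C a) (quot C a V) =
  (1 - 'X) * bsum 1 e (V :\ a).
Proof.
transitivity (\sum_(C in G) Y [set a] C * \sum_(B in G) X C B * (1 * Z 1 B V)).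
  apply: eq_big => [C|C /and3P[aC CV Cc]]; first by rewrite inE.
  have CG : C \in G by rewrite inE aC CV.
  by rewrite XZ // CV /Y /Z sub1set aC.
under eq_bigr do rewrite big_distrr /=.
rewrite exchange_big /= (bigD1 [set a]) //= [X in _ + X]big1 ?addr0; last first.
  move=> B /andP[BG Ba]; under eq_bigr do rewrite mulrA.
  by rewrite -big_distrl /= YX // eq_sym (negPf Ba) mul0r.
under eq_bigr do rewrite mulrA.
by rewrite -big_distrl /= YX // eqxx mul1r /Z sub1set aV.
Qed.

End Recursion.

(** * Sign-twisted gamma-positivity *)

(* [sgpos d p]: the polynomial [(-1) ^+ d *: p] is gamma-positive of formal
   degree [d] or zero.  Signs are carried by the generator [- (1 + 'X)]. *)
Inductive sgpos : nat -> {poly int} -> Prop :=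
| sgpos_zero d : sgpos d 0
| sgpos_mon i j : sgpos (i + j.*2) ((- (1 + 'X)) ^+ i * 'X^j)
| sgpos_add d p q : sgpos d p -> sgpos d q -> sgpos d (p + q).

Lemma sgpos_mul c d p q : sgpos c p -> sgpos d q -> sgpos (c + d) (p * q).
Proof.
move=> Hp Hq; elim: {c p} Hp => [c|i j|c p p' _ IHp _ IHp'].
- by rewrite mul0r; apply: sgpos_zero.
- elim: {d q} Hq => [d|k l|d q q' _ IHq _ IHq'].
  + by rewrite mulr0; apply: sgpos_zero.
  + have -> : (i + j.*2 + (k + l.*2) = (i + k) + (j + l).*2)%N by lia.
    by rewrite mulrACA -!exprD; apply: sgpos_mon.
  + by rewrite mulrDr; apply: sgpos_add.
by rewrite mulrDl; apply: sgpos_add.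
Qed.

Lemma sgpos_sum (I : finType) (P : pred I) d (F : I -> {poly int}) :
  (forall i, P i -> sgpos d (F i)) -> sgpos d (\sum_(i | P i) F i).
Proof.
move=> H; elim/big_rec: _ => [|i p Pi Hp]; first exact: sgpos_zero.
by apply: sgpos_add; first apply: H.
Qed.

Lemma sgpos_prod (I : finType) (P : pred I) (d : I -> nat) (F : I -> {poly int}) :
  (forall i, P i -> sgpos (d i) (F i)) ->
  sgpos (\sum_(i | P i) d i) (\prod_(i | P i) F i).
Proof.
move=> H; elim/big_rec2: _ => [|i p n Pi Hp]; first by have := sgpos_mon 0 0; rewrite !expr0 mulr1.
by apply: sgpos_mul => //; apply: H.
Qed.

(** At 0 the generator [- (1 + 'X)] is -1, while each factor ['X] counts twice in the degree and
    leaves the sign unchanged. *)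
Lemma sgpos_at0 d p : sgpos d p -> 0 <= (-1) ^+ d * p.[0].
Proof.
elim=> {d p} [d|i j|d p q _ IHp _ IHq]; first by rewrite horner0 mulr0.
  have -> : ((- (1 + 'X)) ^+ i * 'X^j : {poly int}).[0] = (-1) ^+ i * 0 ^+ j.
    by rewrite hornerM horner_exp hornerXn hornerN hornerD hornerC hornerX addr0.
  rewrite exprD -mul2n exprM sqrrN !expr1n mulr1.
  by rewrite mulrA -exprMn mulN1r opprK expr1n mul1r expr0n ler0n.
by rewrite hornerD mulrDr addr_ge0.
Qed.

(** * Positivity by induction at a simplicial vertex *)

Section Positivity.
Variable T : finType.
Implicit Types (e : rel T) (A B C S V X H : {set T}).

(** For connected [H] this is [bterm e H] divided by [1 - 'X]; a single vertex gives [1 - 'X^2]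
    before the division. *)
Definition bweight e H : {poly int} := if #|H| == 1%N then 1 + 'X else bsum 1 e H.

Lemma bterm0 e : bterm e set0 = 1 - 'X.
Proof. by rewrite /bterm !bsum0 mulr1. Qed.

Lemma btermE e H : conn e H -> bterm e H = (1 - 'X) * bweight e H.
Proof.
move=> Hc; rewrite /bterm /bweight; case: eqP => [/eqP/cards1P[x ->]|/eqP H1].
  by rewrite !bsum1; ring.
rewrite bsum_conn //; first by ring.
by rewrite ltn_neqAle eq_sym H1 card_gt0 (conn_neq0 Hc).
Qed.

Lemma conn2 e x y : symmetric e -> e x y -> conn e [set x; y].
Proof.
move=> es exy; rewrite conn_connected_block; last by apply/set0Pn; exists x; rewrite !inE eqxx.
have c u v : u \in [set x; y] -> v \in [set x; y] -> e u v ->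
    connect (induced e [set x; y]) u v.
  by move=> uS vS euv; apply: connect1; apply/and3P.
apply/forall_inP=> u uS; apply/forall_inP=> v vS.
move: (uS) (vS); rewrite !inE => /orP[]/eqP Eu /orP[]/eqP Ev; subst u v;
  rewrite ?connect0 // c // es //.
Qed.

Section Step.
Variables (e : rel T) (V : {set T}) (a : T).
Hypotheses (esym : symmetric e) (Vc : conn e V) (aV : simplicial e V a).
Hypothesis V1 : (1 < #|V|)%N.

Definition contractible C := [&& a \in C, C \subset V, conn e C & C != [set a]].

Lemma contractible_bterm C : contractible C ->
  conn e (C :\ a) /\ bterm e (C :\ a) = (1 - 'X) * bweight e (C :\ a).
Proof.
case/and4P=> aC CV Cc Ca.
have Cac : conn e (C :\ a).
  apply: conn_simplicialD1 => //.
    split=> // x y xC yC; apply: (proj2 aV); exact: (subsetP CV).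
  rewrite ltnNge; apply: contra Ca => C1; rewrite eq_sym eqEcard sub1set aC.
  by rewrite cards1.
by split=> //; apply: btermE.
Qed.

(** Every term carries a factor [1 - 'X]: for [[set a]] it is the value of [bterm] at the empty set,
    and otherwise it comes from [btermE], as [C :\ a] stays connected. *)
Let split_sum (F : {set T} -> {poly int}) :
  \sum_(C : {set T} | [&& a \in C, C \subset V & conn e C]) bterm e (C :\ a) * F C =
  (1 - 'X) * (F [set a] + \sum_(C | contractible C) bweight e (C :\ a) * F C).
Proof.
rewrite (bigD1 [set a]) /=; last by rewrite set11 sub1set conn1 (proj1 aV).
rewrite setDv bterm0 mulrDr big_distrr /=; congr (_ + _).
apply: eq_big => [C|C /andP[/and3P[aC CV Cc] Ca]].
  by rewrite /contractible; case: (a \in C); case: (C \subset V).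
have [|_ ->] := contractible_bterm (C := C); first exact/and4P.
by rewrite mulrA.
Qed.

Lemma bpoly_simplicial :
  bpoly e V = \sum_(C | contractible C)
    - bweight e (C :\ a) * bpoly (identify e C a) (quot C a V).
Proof.
have := bpoly_contract esym Vc (proj1 aV) V1; rewrite split_sum quot1 ?(proj1 aV) //.
move/eqP; rewrite mulf_eq0 (negPf subr1X_neq0) /= addr_eq0 => /eqP.
rewrite (@eq_bpoly _ _ e); last by move=> x y _ _ xy; rewrite identify1.
by move=> ->; rewrite -sumrN; apply: eq_bigr => C _; rewrite mulNr.
Qed.

(** In [bsum_contract], the term of [[set a]] is P_V(1), and the term of [V] is the weight of
    [V :\ a]. The latter cancels the right-hand side, except that a single vertex has weight
    [1 + 'X] in place of 1; this leaves ['X] when [V] has two vertices. *)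
Lemma bsum_simplicial :
  - bsum 1 e V = (if #|V| == 2 then 'X else 0) +
    \sum_(C | contractible C && (C != V))
    - bweight e (C :\ a) * - bsum 1 (identify e C a) (quot C a V).
Proof.
have := bsum_contract esym Vc (proj1 aV); rewrite split_sum quot1 ?(proj1 aV) //.
move/(mulfI subr1X_neq0).
rewrite (@eq_bsum _ _ _ e); last by move=> x y _ _ xy; rewrite identify1.
have Vcon : contractible V.
  rewrite /contractible (proj1 aV) subxx Vc /=.
  by apply: contraTneq V1 => ->; rewrite cards1.
rewrite (bigD1 V) //= quot_id bsum1 mulr1.
have -> : bweight e (V :\ a) = bsum 1 e (V :\ a) + if #|V| == 2 then 'X else 0.
  rewrite /bweight (cardsD1 a V) (proj1 aV) add1n eqSS.
  by case: eqP => [/eqP/cards1P[x ->]|_]; rewrite ?bsum1 ?addr0.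
move=> E; under eq_bigr do rewrite mulrNN.
move: E; move: (bsum 1 e V) (bsum 1 e (V :\ a)) (if _ then _ else _) (\sum_(_ | _) _).
move=> p q d s E; have -> : p = q - (q + d + s) by rewrite -{1}E; ring.
by ring.
Qed.

End Step.

(** The claims are proved together because the recursions multiply weights, which involve P of
    [C :\ a], by values on the quotient by [C]. The strict inequality at 0 is what later fixes the
    degree. For a single vertex - P(1) is -1, which explains the restriction on [n] in the last
    claim. *)
Lemma bpoly_sgpos n e V : symmetric e -> conn e V -> simplicial_hereditary e V ->
  #|V| = n.+1 ->
  [/\ sgpos n (bpoly e V), 0 < (-1) ^+ n * (bpoly e V).[0] &
      (0 < n)%N -> sgpos n.+1 (- bsum 1 e V)].
Proof.
elim/ltn_ind: n e V => n IHn e V es Vc sV Vn.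
case: n => [|n] in IHn Vn *.
  have /cards1P[x ->] : #|V| == 1%N by rewrite Vn.
  rewrite bpoly1 hornerC; split=> //.
  by have := sgpos_mon 0 0; rewrite !expr0 mulr1.
have V1 : (1 < #|V|)%N by rewrite Vn.
have [a aV] := sV V (subxx V) (conn_neq0 Vc); have [aVV sa] := aV.
(* Here [V] has n + 2 vertices. If [C] has k + 2, its weight has formal degree k + 1, and the
   quotient, with n - k + 1 vertices, contributes n - k for M and n - k + 1 for P. *)
have IH C : contractible e V a C -> exists k, [/\ (k <= n)%N, #|C| = k.+2,
    sgpos k.+1 (- bweight e (C :\ a)) &
    [/\ sgpos (n - k) (bpoly (identify e C a) (quot C a V)),
        0 < (-1) ^+ (n - k) * (bpoly (identify e C a) (quot C a V)).[0] &
        C != V -> sgpos (n - k).+1 (- bsum 1 (identify e C a) (quot C a V))]].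
  move=> Ccon; have [Cac _] := contractible_bterm es aV Ccon.
  have /and4P[aC CV Cc Ca] := Ccon.
  have /card_gt0P[x0 x0C] : (0 < #|C :\ a|)%N by rewrite card_gt0 (conn_neq0 Cac).
  have cC : #|C| = #|C :\ a|.+1 by rewrite (cardsD1 a C) aC.
  have [k kE] : exists k, #|C :\ a| = k.+1.
    by exists #|C :\ a|.-1; rewrite prednK // card_gt0 (conn_neq0 Cac).
  rewrite kE in cC; have kn : (k <= n)%N.
    by have := subset_leq_card CV; rewrite cC Vn !ltnS.
  have cQ : #|quot C a V| = (n - k).+1.
    apply/eqP; rewrite -(eqn_add2r #|C|) card_quot // Vn cC.
    by rewrite addSn addnS addnS subnK.
  have Qs := identify_sym C a es.
  have Qc := conn_quot es aC CV Vc.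
  have Qh := simplicial_hereditary_quot es aC CV Cc sV.
  have [Q1 Q2 Q3] := IHn (n - k)%N (leq_subr k n) _ _ Qs Qc Qh cQ.
  exists k; split=> //; last first.
    split=> // CnV; apply: Q3; rewrite subn_gt0.
    have : (#|C| < #|V|)%N by apply: proper_card; rewrite properEneq CnV.
    by rewrite cC Vn !ltnS.
  rewrite /bweight kE; case: k kE kn {cC cQ Q1 Q2 Q3} => [|k] kE kn.
    by have := sgpos_mon 1 0; rewrite expr1 expr0 mulr1.
  have hs : simplicial_hereditary e (C :\ a).
    by move=> S SC; apply: sV; apply: subset_trans SC (subset_trans (subD1set _ _) CV).
  by have [_ _ H] := IHn k.+1 kn e _ es Cac hs kE; apply: H.
split.
- rewrite (bpoly_simplicial es Vc aV V1); apply: sgpos_sum => C /IH[k [kn _ Hw [Hq _ _]]].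
  have -> : n.+1 = (k.+1 + (n - k))%N by rewrite addSn subnKC.
  exact: sgpos_mul.
- rewrite (bpoly_simplicial es Vc aV V1) horner_sum big_distrr /=.
  have term C : contractible e V a C ->
    0 <= (-1) ^+ n.+1 * (- bweight e (C :\ a) * bpoly (identify e C a) (quot C a V)).[0].
    move=> /IH[k [kn _ Hw [Hq _ _]]]; apply: sgpos_at0.
    have -> : n.+1 = (k.+1 + (n - k))%N by rewrite addSn subnKC.
    exact: sgpos_mul.
  (* All terms are nonnegative at 0, so one strictly positive term suffices. Contracting an edge at
     [a] gives one: its weight is [1 + 'X], and the quotient is covered by induction. *)
  have [w [wV wa eaw]] := conn_nbr Vc aVV V1.
  have con : contractible e V a [set a; w].
    rewrite /contractible !inE eqxx conn2 // subUset !sub1set aVV wV /=.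
    by apply/eqP=> /setP/(_ w); rewrite !inE eqxx orbT (negPf wa).
  rewrite (bigD1 [set a; w]) //= ltr_wpDr //.
    by apply: sumr_ge0 => C /andP[Cc _]; apply: term.
  have [k [kn kE _ [_ H _]]] := IH _ con.
  have k0 : k = 0%N.
    by move: kE; rewrite cards2 eq_sym wa => -[].
  subst k; rewrite subn0 in H.
  have -> : [set a; w] :\ a = [set w].
    by apply/setP=> x; rewrite !inE; case: eqP => // ->; rewrite eq_sym (negPf wa).
  rewrite /bweight cards1 eqxx hornerM.
  rewrite hornerN hornerD hornerC hornerX addr0.
  by rewrite exprS !mulN1r mulrNN.
move=> _; rewrite (bsum_simplicial es Vc aV V1); apply: sgpos_add.
  case: eqP => [V2|_]; last exact: sgpos_zero.
  have -> : n.+2 = 2%N by rewrite -Vn.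
  by have := sgpos_mon 0 1; rewrite expr0 expr1 mul1r.
apply: sgpos_sum => C /andP[/IH[k [kn _ Hw [_ _ Hq]]] CV].
have -> : n.+2 = (k.+1 + (n - k).+1)%N by rewrite addSn addnS subnKC.
by apply: sgpos_mul => //; apply: Hq.
Qed.

End Positivity.

(** * Moebius values of the weighted bond poset *)

(** Moebius inversion at the minimum: it reduces the computation of [mobius] to sums over lower
    intervals. *)
Lemma mobius_unique d (P : finPOrderType d) (x0 : P) (g : P -> int) :
  (forall y, (x0 <= y)%O) ->
  (forall y, \sum_(z | (z <= y)%O) g z = (y == x0)%:R) ->
  forall y, mobius x0 y = g y.
Proof.
move=> x0min zeta y; have [n] := ubnP #|[pred z | (z <= y)%O]|.
elim: n y => // n IHn y /ltnSE yn.
have := zeta y; rewrite (bigD1 y) //=; have [->|yx0] := eqVneq y x0.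
  rewrite mobius_refl big1 ?addr0 // => z /andP[zx0 /eqP[]].
  by apply/eqP; rewrite eq_le zx0 x0min.
move/eqP; rewrite addr_eq0 => /eqP->; rewrite mobius_neq 1?eq_sym //; congr (- _).
apply: eq_big => [z|z /andP[_ zy]]; first by rewrite x0min lt_neqAle [RHS]andbC.
apply: IHn; apply: leq_trans yn; apply: proper_card; apply/properP; split.
  by apply/subsetP=> t; rewrite !inE => /le_trans; apply; apply: ltW.
by exists y; rewrite !inE ?lexx // lt_geF.
Qed.

Section WeightedCovers.
Variable T : finType.
Notation wset := {set {set T} * 'I_#|T|.+1}.
Implicit Types (pi rho sigma : wset) (S B C : {set T}) (P : {set {set T}}).

(** The ground set is arbitrary so that the notion localizes to a block; the bound on the weights is
    left to [good_block]. *)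
Definition wcover sigma S : bool :=
  partition (blocks sigma) S &&
  [forall a in sigma, [forall b in sigma, (a.1 == b.1) ==> (a == b)]].

Lemma wcoverP sigma S : reflect
  [/\ forall b, b \in sigma -> b.1 != set0 /\ b.1 \subset S,
      forall x, x \in S -> exists2 b, b \in sigma & x \in b.1 &
      forall x b c, b \in sigma -> c \in sigma -> x \in b.1 -> x \in c.1 -> b = c]
  (wcover sigma S).
Proof.
apply: (iffP andP) => [[part /forall_inP inj]|[sub cov uni]]; [split|split].
- move=> b sb; have bB : b.1 \in blocks sigma by apply: imset_f.
  by rewrite (partition_neq0 part bB) (partitionS part bB).
- move=> x; rewrite -(cover_partition part) => /bigcupP[_ /imsetP[b sb ->] xb].
  by exists b.
- move=> x b c sb sc xb xc; apply/eqP/(implyP (forall_inP (inj b sb) c sc)).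
  apply: contraTT xc => bc; have /trivIsetP tI := partition_trivIset part.
  by rewrite (disjointFr (tI _ _ _ _ bc) xb) // imset_f.
- apply/and3P; split.
  + apply/eqP/setP=> x; apply/bigcupP/idP => [[_ /imsetP[b sb ->] xb]|/cov[b sb xb]].
      by case: (sub b sb) => _ /subsetP; apply.
    by exists b.1; rewrite ?imset_f.
  + apply/trivIsetP=> _ _ /imsetP[b sb ->] /imsetP[c sc ->] bc.
    rewrite -setI_eq0; apply: contraNT bc => /set0Pn[x /setIP[xb xc]].
    by rewrite (uni x b c).
  + by apply/imsetP=> -[b /sub[/eqP b0 _] E]; rewrite -E in b0.
- apply/forall_inP=> b sb; apply/forall_inP=> c sc; apply/implyP=> /eqP bc.
  have [/set0Pn[x xb] _] := sub b sb; apply/eqP; apply: (uni x) => //.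
  by rewrite -bc.
Qed.

Lemma wcover_card sigma S : wcover sigma S -> #|blocks sigma| = #|sigma|.
Proof.
case/andP=> _ /forall_inP inj; apply: card_in_imset => b c sb sc bc.
by apply/eqP/(implyP (forall_inP (inj b sb) c sc))/eqP.
Qed.

(** Distributivity: the weighted partitions over [P] are the graphs of functions from [P] to
    weights. *)
Lemma sum_weighted (R : comNzRingType) P (F : {set T} * 'I_#|T|.+1 -> R) :
  \sum_(sigma : wset | (blocks sigma == P) &&
      [forall a in sigma, [forall b in sigma, (a.1 == b.1) ==> (a == b)]])
    \prod_(b in sigma) F b =
  \prod_(B in P) \sum_w F (B, w).
Proof.
rewrite (big_distr_big_dep (ord0 : 'I_#|T|.+1)).
pose h (f : {ffun {set T} -> 'I_#|T|.+1}) : wset := [set (B, f B) | B in P].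
pose h' (sigma : wset) : {ffun {set T} -> 'I_#|T|.+1} :=
  [ffun B => odflt ord0 [pick w | (B, w) \in sigma]].
have hP f b : (b \in h f) = (b.1 \in P) && (b.2 == f b.1).
  apply/imsetP/andP => [[B BP ->]|[BP /eqP bE]] //=.
  by exists b.1 => //; rewrite -bE; case: (b).
have blh f : blocks (h f) = P.
  by rewrite /blocks /h -imset_comp /= imset_id.
have injh f : [forall a in h f, [forall b in h f, (a.1 == b.1) ==> (a == b)]].
  apply/forall_inP=> _ /imsetP[B _ ->]; apply/forall_inP=> _ /imsetP[C _ ->] /=.
  by apply/implyP=> /eqP->.
rewrite (reindex_onto h h') /=; last first.
  move=> sigma /andP[/eqP blP /forall_inP inj]; apply/setP=> -[B w]; rewrite hP /= ffunE.
  case: pickP => [v Bv|noB] /=.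
    have BP : B \in P by rewrite -blP; apply/imsetP; exists (B, v).
    rewrite BP /=; apply/eqP/idP => [->//|Bw].
    have := implyP (forall_inP (inj _ Bv) _ Bw) (eqxx _).
    by rewrite xpair_eqE eqxx => /eqP->.
  rewrite noB; case BP: (B \in P) => //=.
  move: BP; rewrite -blP => /imsetP[[C v] sC /= E]; subst C.
  by rewrite noB in sC.
apply: eq_big => [f|f _].
  rewrite blh eqxx injh /=; apply/eqP/pfamilyP => [<-|[supp _]].
    split=> //; apply/supportP=> B nBP; rewrite ffunE; case: pickP => //= w.
    by rewrite hP (negPf nBP).
  apply/ffunP=> B; rewrite ffunE; case: pickP => [w|noB] /=.
    by rewrite hP /= => /andP[_ /eqP].
  have nBP : B \notin P by apply/negP=> BP; have := noB (f B); rewrite hP /= BP eqxx.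
  by move/supportP/(_ B nBP): supp.
by rewrite big_imset //= => B C _ _ [].
Qed.

(** * Lower intervals as products over blocks, and the Moebius values *)

Section BondSums.
Variable e : rel T.
Implicit Types (p z : wbond e).

Definition good_block (b : {set T} * 'I_#|T|.+1) := (b.2 < #|b.1|)%N && conn e b.1.

Definition is_wbond sigma := wcover sigma [set: T] && [forall b in sigma, good_block b].

Lemma wbondP p : is_wbond p.
Proof.
case: p => -[sigma /= /and3P[part inj lt]] /= /andP[_ /forall_inP bond].
rewrite /is_wbond /wcover part inj; apply/forall_inP=> b sb.
have bB : b.1 \in blocks sigma by apply: imset_f.
rewrite /good_block (forall_inP lt b sb) conn_connected_block ?bond //.
exact: partition_neq0 part bB.
Qed.

Lemma is_wbondE sigma :
  is_wbond sigma = is_wpart sigma && is_bond e (blocks sigma).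
Proof.
rewrite /is_wbond /wcover /is_wpart /is_bond.
case: (boolP (partition _ _)) => //= part; rewrite ?andbF //.
case: (X in X && _ = X && _ && _) => //=.
apply/forall_inP/andP => [good|[/forall_inP lt /forall_inP bond] b sb].
  split; apply/forall_inP; first by move=> b /good/andP[].
  move=> _ /imsetP[b sb ->]; have /andP[lt bc] := good b sb.
  by rewrite -conn_connected_block ?(conn_neq0 bc).
have bB : b.1 \in blocks sigma by apply: imset_f.
rewrite /good_block lt // conn_connected_block ?bond //.
exact: partition_neq0 part bB.
Qed.

Lemma sum_wbond (R : nmodType) (Q : pred wset) (F : wset -> R) :
  \sum_(z : wbond e | Q z) F z = \sum_(sigma | is_wbond sigma && Q sigma) F sigma.
Proof.
pose v (z : wbond e) : wset := z.
rewrite (reindex_omap v (fun s => obind (insub : wpart T -> option (wbond e)) (insub s))) /=.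
  apply: eq_bigl => z; rewrite /v wbondP /=; case Qz: (Q _) => //=.
  by rewrite valK /= valK eqxx.
move=> sigma /andP[]; rewrite is_wbondE => /andP[wp bd] _.
by rewrite insubT /= insubT.
Qed.

Definition block_interval (b : {set T} * 'I_#|T|.+1) rho : bool :=
  [&& wcover rho b.1, [forall c in rho, good_block c] &
      (weight rho <= b.2 < weight rho + #|rho|)%N].

(** One direction of the factorization of a lower interval over the blocks of [p]; [wpart_le_bigcup]
    is the other. *)
Lemma wpart_le_blocks p sigma :
  is_wbond sigma && wpart_le sigma p ->
  forall b, b \in (p : wset) -> block_interval b (below sigma b.1).
Proof.
case/andP=> /andP[/wcoverP[sub cov uni] good] /andP[/refinesP ref /forall_inP le] b pb.
have /andP[/wcoverP[_ _ puni] _] := wbondP p.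
apply/and3P; split; last exact: le.
  apply/wcoverP; split.
  - by move=> c; rewrite inE => /andP[sc cb]; case: (sub c sc).
  - move=> x xb; have [c sc xc] := cov x (in_setT x); exists c => //.
    have [b' pb' cb'] := ref c sc; rewrite inE sc.
    by rewrite (puni x b b') //; apply: (subsetP cb').
  - move=> x c d; rewrite !inE => /andP[sc _] /andP[sd _]; exact: uni.
by apply/forall_inP=> c; rewrite inE => /andP[sc _]; apply: (forall_inP good).
Qed.

Lemma bigcup_below p (f : {set T} * 'I_#|T|.+1 -> wset) :
  (forall b, b \in (p : wset) -> block_interval b (f b)) ->
  forall b, b \in (p : wset) -> below (\bigcup_(b in (p : wset)) f b) b.1 = f b.
Proof.
move=> fP b pb; have /andP[/wcoverP[_ _ puni] _] := wbondP p.
apply/setP=> c; rewrite inE; apply/andP/idP => [[/bigcupP[b' pb' fc] cb]|fc].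
  have /and3P[/wcoverP[sub _ _] _ _] := fP b' pb'.
  have [/set0Pn[x xc] cb'] := sub c fc.
  by rewrite (puni x b b') //; [apply: (subsetP cb) | apply: (subsetP cb')].
have /and3P[/wcoverP[sub _ _] _ _] := fP b pb.
by split; [apply/bigcupP; exists b | case: (sub c fc)].
Qed.

Lemma wpart_le_bigcup p (f : {set T} * 'I_#|T|.+1 -> wset) :
  (forall b, b \in (p : wset) -> block_interval b (f b)) ->
  is_wbond (\bigcup_(b in (p : wset)) f b) &&
  wpart_le (\bigcup_(b in (p : wset)) f b) p.
Proof.
move=> fP; have bel := bigcup_below fP; set sigma := \bigcup_(_ in _) _ in bel *.
have /andP[/wcoverP[_ pcov puni] _] := wbondP p.
have sP c : c \in sigma -> exists b, [/\ b \in (p : wset), c \in f b & c.1 \subset b.1].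
  case/bigcupP=> b pb fc; exists b; split=> //.
  by have /and3P[/wcoverP[sub _ _] _ _] := fP b pb; case: (sub c fc).
apply/andP; split; last first.
  apply/andP; split.
    by apply/refinesP=> c /sP[b [pb _ cb]]; exists b.
  by apply/forall_inP=> b pb; rewrite bel //; case/and3P: (fP b pb).
apply/andP; split; last first.
  apply/forall_inP=> c /sP[b [pb fc _]].
  by have /and3P[_ /forall_inP good _] := fP b pb; apply: good.
apply/wcoverP; split.
- move=> c /sP[b [pb fc _]]; split=> //.
  by have /and3P[/wcoverP[sub _ _] _ _] := fP b pb; case: (sub c fc).
- move=> x _; have [b pb xb] := pcov x (in_setT x).
  have /and3P[/wcoverP[_ cov _] _ _] := fP b pb.
  by have [c fc xc] := cov x xb; exists c => //; apply/bigcupP; exists b.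
- move=> x c d /sP[b [pb fc cb]] /sP[b' [pb' fd db]] xc xd.
  have bb' : b = b' by apply: (puni x); rewrite ?(subsetP cb) ?(subsetP db).
  subst b'; have /and3P[/wcoverP[_ _ uni] _ _] := fP b pb; exact: (uni x).
Qed.

Lemma prod_below p sigma (F : {set T} * 'I_#|T|.+1 -> int) :
  is_wbond sigma && wpart_le sigma p ->
  \prod_(c in sigma) F c = \prod_(b in (p : wset)) \prod_(c in below sigma b.1) F c.
Proof.
case/andP=> /andP[/wcoverP[sub cov uni] good] /andP[/refinesP ref /forall_inP le].
have /andP[/wcoverP[_ _ puni] _] := wbondP p.
rewrite (exchange_big_dep (mem sigma)) /=; last first.
  by move=> b c _; rewrite inE => /andP[].
apply: eq_bigr => c sc; have [b pb cb] := ref c sc.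
rewrite (big_pred1 b) // => b' /=; rewrite inE sc /=.
apply/andP/eqP => [[pb' cb']|->] //.
have [/set0Pn[x xc] _] := sub c sc.
by apply: (puni x); rewrite ?(subsetP cb) ?(subsetP cb').
Qed.

(** Restriction to each block of [p] and union over these blocks are inverse bijections, after which
    the product of sums is expanded. *)
Lemma zeta_prod p (F : {set T} * 'I_#|T|.+1 -> int) :
  \sum_(z : wbond e | (z <= p)%O) \prod_(c in (z : wset)) F c =
  \prod_(b in (p : wset)) \sum_(rho | block_interval b rho) \prod_(c in rho) F c.
Proof.
rewrite (big_distr_big_dep (set0 : wset)).
rewrite (eq_bigl (fun z : wbond e => wpart_le z p)); last first.
  by [].
rewrite (sum_wbond (fun s => wpart_le s p) (fun s => \prod_(c in s) F c)).
pose h (f : {ffun {set T} * 'I_#|T|.+1 -> wset}) : wset := \bigcup_(b in (p : wset)) f b.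
(* The value [set0] outside [p] is the default required by [pfamily]. *)
pose h' (sigma : wset) : {ffun {set T} * 'I_#|T|.+1 -> wset} :=
  [ffun b => if b \in (p : wset) then below sigma b.1 else set0].
rewrite (reindex_onto h h') /=; last first.
  move=> sigma /andP[/andP[/wcoverP[sub cov uni] good] /andP[/refinesP ref _]].
  apply/setP=> c; apply/bigcupP/idP => [[b pb]|sc].
    by rewrite ffunE pb inE => /andP[].
  have [b pb cb] := ref c sc; exists b => //; by rewrite ffunE pb inE sc.
have pf (f : {ffun {set T} * 'I_#|T|.+1 -> wset}) : reflect
    ((forall b, b \in (p : wset) -> block_interval b (f b)) /\ h' (h f) = f)
    (f \in pfamily set0 (mem (p : wset)) block_interval).
  apply: (iffP idP) => [/pfamilyP[supp fP]|[fP hh]].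
    split=> //; apply/ffunP=> b; rewrite ffunE; case: ifP => [pb|npb].
      by rewrite /h bigcup_below.
    by move/supportP/(_ b (negbT npb)): supp.
  apply/pfamilyP; split=> //; apply/supportP=> b npb.
  by rewrite -hh ffunE (negPf npb).
apply: eq_big => [f|f /andP[le /eqP hh]].
  apply/andP/pf => [[le /eqP hh]|[fP ->]]; last by rewrite [_ && _]wpart_le_bigcup.
  split=> // b pb; have -> : f b = below (h f) b.1 by rewrite -{1}hh ffunE pb.
  exact: (wpart_le_blocks le pb).
rewrite (prod_below _ le); apply: eq_bigr => b pb; apply: eq_bigl => c.
by have -> : f b = below (h f) b.1 by rewrite -{1}hh ffunE pb.
Qed.

Definition wcoef (b : {set T} * 'I_#|T|.+1) : int := (bpoly e b.1)`_b.2.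

(** This vanishing allows sums over all weights in ['I_#|T|.+1] and over possibly disconnected
    blocks. *)
Lemma wcoef_bad b : ~~ good_block b -> wcoef b = 0.
Proof.
rewrite negb_and -leqNgt => /orP[b2|ncb].
  by rewrite /wcoef nth_default // (leq_trans (size_bpoly e b.1) b2).
by rewrite /wcoef bpoly_nconn // coef0.
Qed.

Lemma sum_wcoef_poly B : \sum_w wcoef (B, w) *: 'X^w = bpoly e B.
Proof.
rewrite -[RHS]coefK poly_def; symmetry.
have sB := leqW (leq_trans (size_bpoly e B) (max_card (mem B))).
rewrite (big_ord_widen _ (fun i => (bpoly e B)`_i *: 'X^i) sB).
rewrite big_mkcond /=; apply: eq_bigr => i _; case: ltnP => // le.
by rewrite /wcoef /= nth_default // scale0r.
Qed.

Lemma prod_wcoef (rho : wset) :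
  \prod_(c in rho) (wcoef c *: 'X^(c.2)) = (\prod_(c in rho) wcoef c) *: 'X^(weight rho).
Proof. by rewrite scaler_prod /weight -prodrXr. Qed.

Lemma prod_wcoef_bad (rho : wset) :
  ~~ [forall c in rho, good_block c] -> \prod_(c in rho) wcoef c = 0.
Proof.
rewrite negb_forall_in => /exists_inP[c rc nc].
by rewrite (bigD1 c) //= wcoef_bad // mul0r.
Qed.

(** Coefficient extraction encodes the weight condition in the order relation. *)
Lemma coef_qintZX l (c : int) w v :
  (qint l * (c *: 'X^w))`_v = if (w <= v < w + l)%N then c else 0.
Proof.
rewrite -scalerAr coefZ coefMXn /qint coef_sum.
case: ltnP => [_|wv] /=; first by rewrite mulr0.
rewrite (eq_bigr (fun i : 'I_l => (v - w == i)%N%:R)) => [|i _]; last by rewrite coefXn.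
case: ltnP => [vl|lv].
  have vwl : (v - w < l)%N by rewrite ltn_subLR.
  rewrite (bigD1 (Ordinal vwl)) //= eqxx big1 ?addr0 ?mulr1 // => i.
  by rewrite -val_eqE /= eq_sym => /negPf->.
rewrite big1 ?mulr0 // => i _; rewrite (_ : _ == _ = false) //.
by apply/gtn_eqF; apply: leq_trans (ltn_ord i) _; rewrite leq_subRL.
Qed.

Lemma block_interval_sum b :
  \sum_(rho | block_interval b rho) \prod_(c in rho) wcoef c =
  (\sum_(P | partition P b.1) qint #|P| * \prod_(C in P) bpoly e C)`_b.2.
Proof.
transitivity (\sum_(rho | wcover rho b.1)
    (qint #|rho| * \prod_(c in rho) (wcoef c *: 'X^(c.2)))`_b.2).
  rewrite big_mkcond [RHS]big_mkcond /=; apply: eq_bigr => rho _.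
  rewrite prod_wcoef coef_qintZX /block_interval; case: (wcover _ _) => //=.
  by case: (boolP [forall c in _, _]) => //= /prod_wcoef_bad->; rewrite if_same.
rewrite -coef_sum; apply: (congr1 (fun p : {poly int} => p`_b.2)).
rewrite (partition_big (fun rho => blocks rho) (fun P => partition P b.1)) /=; last first.
  by move=> rho /andP[].
apply: eq_bigr => P partP.
under [X in _ * X]eq_bigr => C _ do rewrite -sum_wcoef_poly.
rewrite -(sum_weighted P (fun c => wcoef c *: 'X^(c.2))) big_distrr /=.
apply: eq_big => [rho|rho /andP[cov /eqP blr]]; last by rewrite -blr (wcover_card cov).
by rewrite /wcover andbC; case: eqP => [->|] //=; rewrite partP.
Qed.

Lemma block_interval_sumE b : good_block b ->
  \sum_(rho | block_interval b rho) \prod_(c in rho) wcoef c = (#|b.1| == 1)%:R.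
Proof.
case/andP=> b2 bc; rewrite block_interval_sum.
case: eqP => [b1|/eqP b1]; last first.
  rewrite bpoly_rel ?coef0 // ltn_neqAle eq_sym b1.
  by rewrite card_gt0 (conn_neq0 bc).
have b20 : b.2 = 0%N :> nat by apply/eqP; rewrite b1 ltnS leqn0 in b2.
have /cards1P[x bx] : #|b.1| == 1%N by rewrite b1.
(* For a single vertex, [qint_sum] reads [1 - 'X] times the sum equals [1 - 'X], so the sum is 1. *)
have E := qint_sum e b.1.
rewrite {2 3}bx !bsum1 -[RHS]mulr1 in E.
by rewrite (mulfI subr1X_neq0 E) b20 coef1.
Qed.

Lemma wbond0P p :
  reflect (forall b, b \in (p : wset) -> #|b.1| = 1%N) (p == wbond0 e).
Proof.
apply: (iffP eqP) => [->|p1].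
  by move=> _ /imsetP[x _ ->] /=; rewrite cards1.
have /andP[/wcoverP[_ cov _] /forall_inP good] := wbondP p.
have pE b : b \in (p : wset) -> exists x, b = ([set x], ord0).
  move=> pb; have /eqP/cards1P[x bx] := p1 b pb; exists x.
  have /andP[b2 _] := good b pb.
  case: b pb b2 bx => B w /= _ b2 bx; rewrite bx cards1 ltnS leqn0 in b2 *.
  by congr (_, _); apply/val_inj/eqP.
apply/val_inj/val_inj/setP=> b /=; apply/idP/imsetP => [/pE[x ->]|[x _ ->]].
  by exists x.
have [c pc xc] := cov x (in_setT x); have [y cE] := pE c pc.
by move: xc pc; rewrite cE /= => /set1P->.
Qed.

(** By [zeta_prod] and [block_interval_sumE], the sum over a lower interval is a product of
    indicators that each block is a singleton, hence the indicator of the minimum. *)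
Lemma mobius_wbond p : mobius (wbond0 e) p = \prod_(b in (p : wset)) wcoef b.
Proof.
apply: (mobius_unique (g := fun p : wbond e => \prod_(b in (p : wset)) wcoef b)).
  exact: wbond0_le.
move=> {}p; rewrite zeta_prod; have /andP[_ /forall_inP good] := wbondP p.
transitivity (\prod_(b in (p : wset)) (#|b.1| == 1)%:R : int).
  apply: eq_bigr; by move=> b pb; rewrite block_interval_sumE // good.
case: (boolP (p == wbond0 e)) => [/wbond0P p1|np0].
  by rewrite big1 // => b pb; rewrite p1.
have /exists_inP[b pb nb1] : [exists b in (p : wset), #|b.1| != 1%N].
  apply: contraR np0; rewrite negb_exists_in => /forall_inP H.
  by apply/wbond0P=> b pb; apply/eqP; rewrite -[_ == _]negbK H.
by rewrite (bigD1 b) //= (negPf nb1) mul0r.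
Qed.

End BondSums.

End WeightedCovers.

(** * The Moebius polynomial *)

Section Components.
Variables (T : finType) (e : rel T).
Hypothesis esym : symmetric e.
Implicit Types (x y : T) (B C : {set T}).

Definition components : {set {set T}} := [set component e [set: T] x | x : T].

Lemma in_componentT x y : (y \in component e [set: T] x) = connect e x y.
Proof.
rewrite inE /=; rewrite inE /=; apply: eq_connect => u v.
by rewrite /induced /= !inE.
Qed.

Lemma component_eq x y :
  y \in component e [set: T] x ->
  component e [set: T] y = component e [set: T] x.
Proof.
rewrite in_componentT => xy; apply/setP=> z; rewrite !in_componentT.
by rewrite (same_connect (sym_connect_sym esym) xy).
Qed.

Lemma partition_components : partition components [set: T].
Proof.
apply/and3P; split.
- apply/eqP/setP=> x; rewrite inE; apply/bigcupP.
  by exists (component e [set: T] x); rewrite ?imset_f // component_id.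
- apply/trivIsetP=> _ _ /imsetP[x _ ->] /imsetP[y _ ->]; apply: contraR.
  rewrite -setI_eq0 => /set0Pn[z /setIP[/component_eq<- /component_eq<-]].
  exact: eqxx.
by apply/imsetP=> -[x _ /setP/(_ x)]; rewrite component_id ?inE.
Qed.

Lemma conn_components C : C \in components -> conn e C.
Proof. by case/imsetP=> x _ ->; apply: conn_component. Qed.

Lemma conn_sub_component B x : conn e B -> x \in B -> B \subset component e [set: T] x.
Proof.
move=> Bc xB; apply/subsetP=> y yB; rewrite in_componentT.
have B0 := conn_neq0 Bc; rewrite conn_connected_block // in Bc.
have := forall_inP (forall_inP Bc x xB) y yB.
by apply: connect_sub => u v /and3P[_ _ euv]; apply: connect1.
Qed.

Lemma card_components : #|components| = n_comp e T.
Proof.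
have cs := sym_connect_sym esym.
rewrite /n_comp_mem; have -> : components = [set component e [set: T] x | x in roots e].
  apply/setP=> C; apply/imsetP/imsetP => -[x]; last by exists x.
  move=> _ ->; exists (fingraph.root e x); first by rewrite unfold_in /= root_root // eqxx.
  by symmetry; apply: component_eq; rewrite in_componentT connect_root.
rewrite card_in_imset => [|x y]; first by apply: eq_card => x; rewrite !inE andbT.
move=> /eqP rx /eqP ry xy; rewrite -rx -ry; apply/eqP; rewrite root_connect //.
by rewrite -in_componentT xy component_id ?inE.
Qed.

(** Each block of [p] inside [C] has weight at most its size minus one, and these blocks partition
    [C]. So their total weight is admissible for the merged block [C]. *)
Lemma below_weight_lt (p : wbond e) C : C \in components ->
  (weight (below p C) < #|C|)%N /\ (0 < #|below p C|)%N.
Proof.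
move=> Ccomp; have /andP[/wcoverP[sub cov uni] /forall_inP good] := wbondP p.
have bcov : wcover (below p C) C.
  apply/wcoverP; split.
  - by move=> b; rewrite inE => /andP[pb bC]; case: (sub b pb).
  - move=> x xC; have [b pb xb] := cov x (in_setT x); exists b; rewrite // inE pb /=.
    have /andP[_ bc] := good b pb.
    case/imsetP: Ccomp xC => y _ -> /component_eq <-; exact: conn_sub_component.
  - by move=> x b c; rewrite !inE => /andP[pb _] /andP[pc _]; apply: uni.
have b0 : (0 < #|below p C|)%N.
  have /set0Pn[x xC] := conn_neq0 (conn_components Ccomp).
  by have /wcoverP[_ /(_ x xC)[b bb _] _] := bcov; apply/card_gt0P; exists b.
split=> //; have /andP[part _] := bcov.
rewrite (card_partition part) big_imset /=; last first.
  case/andP: bcov => _ /forall_inP inj b c bb bc E.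
  by apply/eqP/(implyP (forall_inP (inj b bb) c bc))/eqP.
apply: leq_trans (_ : weight (below p C) + #|below p C| <= _)%N.
  by rewrite -[X in (X < _)%N]addn0 ltn_add2l.
rewrite -sum1_card -big_split /=; apply: leq_sum => b; rewrite inE addn1 => /andP[pb _].
by have /andP[] := good b pb.
Qed.

Lemma maximal_components (p : wbond e) : maximal_elt p = (blocks p == components).
Proof.
have /andP[/wcoverP[psub pcov puni] /forall_inP pgood] := wbondP p.
apply/forallP/eqP => [pmax|blp q].
  (* Merging the blocks of [p] inside each component and adding their weights gives an element above
     [p], which maximality identifies with [p]. *)
  pose s : {set {set T} * 'I_#|T|.+1} :=
    [set (C, inord (weight (below p C))) | C in components].
  have bls : blocks s = components by rewrite /blocks /s -imset_comp /= imset_id.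
  have wE C : C \in components ->
      (inord (weight (below p C)) : 'I_#|T|.+1) = weight (below p C) :> nat.
    move=> Ccomp; rewrite inordK // ltnS ltnW //.
    by have [lt _] := below_weight_lt p Ccomp; apply: leq_trans lt (max_card _).
  have sw : is_wbond e s.
    apply/andP; split.
      apply/andP; split; first by rewrite bls partition_components.
      apply/forall_inP=> _ /imsetP[B _ ->]; apply/forall_inP=> _ /imsetP[C _ ->] /=.
      by apply/implyP=> /eqP->.
    apply/forall_inP=> _ /imsetP[C Ccomp ->]; rewrite /good_block /= wE //.
    by rewrite conn_components // andbT; case: (below_weight_lt p Ccomp).
  move: sw; rewrite is_wbondE => /andP[wp bd].
  pose q : wbond e := WBond (wbond_val := WPart wp) bd.
  have pq : (p <= q)%O.
    apply/andP; split.
      apply/refinesP=> b pb; have [/set0Pn[x xb] _] := psub b pb.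
      have /andP[_ bc] := pgood b pb.
      exists (component e [set: T] x, inord (weight (below p (component e [set: T] x)))).
        by rewrite imset_f // imset_f.
      exact: conn_sub_component.
    apply/forall_inP=> _ /imsetP[C Ccomp ->] /=; rewrite wE // leqnn /=.
    by rewrite -[X in (X < _)%N]addn0 ltn_add2l; case: (below_weight_lt p Ccomp).
  have := pmax q; rewrite lt_neqAle pq andbT negbK => /eqP pqE.
  by rewrite -bls {1}pqE.
(* A connected block of [q] containing a component equals it, and over a single block the order
   allows no excess of weight; hence [q] equals [p]. *)
apply/negP=> pq; have := pq; rewrite lt_neqAle => /andP[npq /andP[/refinesP ref /forall_inP le]].
have /andP[/wcoverP[qsub qcov quni] /forall_inP qgood] := wbondP q.
case/eqP: npq; suff : wpart_val q = wpart_val p.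
  move=> E; have valE : wbond_val q = wbond_val p by apply: val_inj.
  by apply: val_inj; rewrite /= valE.
have qp b : b \in wpart_val q -> b \in wpart_val p.
  move=> qb; have [/set0Pn[x xb] _] := qsub b qb; have /andP[_ bc] := qgood b qb.
  have [c pc xc] := pcov x (in_setT x); have [b' qb' cb'] := ref c pc.
  have bb' : b' = b by apply: (quni x) => //; apply: (subsetP cb').
  subst b'; have cb : c.1 = b.1.
    apply/eqP; rewrite eqEsubset cb' /=.
    have : c.1 \in components by rewrite -blp imset_f.
    case/imsetP=> y _ cE; move: xc; rewrite cE => /component_eq<-.
    exact: conn_sub_component.
  have := le b qb; rewrite -cb below_self // /weight big_set1 cards1 addn1 ltnS -eqn_leq.
  move/eqP/val_inj => cb2; rewrite (_ : b = c) //.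
  by case: (b) (c) cb cb2 => B w [C v] /= -> ->.
apply/setP=> b; apply/idP/idP => [/qp//|pb].
have [/set0Pn[x xb] _] := psub b pb; have [c qc xc] := qcov x (in_setT x).
by rewrite (puni x b c) // qp.
Qed.

(** The maximal elements are the admissible weightings of the components. Inadmissible weightings
    contribute 0, so the sum factors by [sum_weighted]. *)
Lemma mobius_poly_prod : mobius_poly e = \prod_(C in components) bpoly e C.
Proof.
rewrite /mobius_poly (eq_bigl _ _ maximal_components).
under eq_bigr do rewrite mobius_wbond -prod_wcoef.
rewrite (sum_wbond e (fun s => blocks s == components)
  (fun s => \prod_(c in s) (wcoef e c *: 'X^(c.2)))).
transitivity (\prod_(C in components) \sum_w wcoef e (C, w) *: 'X^w); last first.
  by apply: eq_bigr => C _; rewrite sum_wcoef_poly.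
rewrite -(sum_weighted components (fun c => wcoef e c *: 'X^(c.2))).
rewrite big_mkcond [RHS]big_mkcond /=; apply: eq_bigr => s _.
rewrite /is_wbond /wcover; case: eqP => [->|_] /=; last by rewrite andbF.
rewrite partition_components andbT /=; case: ifP => [/andP[-> //]|].
case: ifP => //= _ /negbT ng; rewrite prod_wcoef prod_wcoef_bad ?scale0r //.
Qed.

End Components.

(** * From signed positivity to gamma-positivity over the reals *)

Lemma sgpos_gamma d p : sgpos d p -> exists gamma : nat -> nat,
  (-1) ^+ d *: p = \sum_(0 <= j < d./2.+1) (gamma j)%:R *: ('X^j * (1 + 'X) ^+ (d - 2 * j)).
Proof.
elim=> {d p} [d|i j|d p q _ [g gE] _ [g' gE']].
- by exists (fun=> 0%N); rewrite scaler0 big1 // => j _; rewrite scale0r.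
- exists (fun k => (k == j)%N : nat).
  have jd : (j < (i + j.*2)./2.+1)%N by rewrite ltnS halfD doubleK odd_double andbF add0n leq_addl.
  rewrite big_mkord (bigD1 (Ordinal jd)) //= eqxx scale1r big1 ?addr0; last first.
    by move=> k; rewrite -val_eqE /= => /negPf->; rewrite scale0r.
  rewrite mul2n addnK -[- (1 + 'X)]mulN1r exprMn -mulrA -(rmorph1 polyC) -rmorphN -rmorphXn.
  rewrite mul_polyC scalerA -exprD addnAC addnn -doubleD -mul2n exprM sqrrN !expr1n scale1r.
  by rewrite rmorph1 mulrC.
exists (fun j => g j + g' j)%N; rewrite scalerDr gE gE' -big_split /=.
by apply: eq_bigr => j _; rewrite natrD scalerDl.
Qed.

Lemma size_exp_1DX i : size ((1 + 'X) ^+ i : {poly int}) = i.+1.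
Proof.
have -> : 1 + 'X = 'X - (-1)%:P :> {poly int} by rewrite polyCN opprK polyC1 addrC.
exact: size_exp_XsubC.
Qed.

(** The constant term is [gamma 0]. If it is nonzero, the summand j = 0 has degree d, and every
    other summand has degree at most d - j, so the top coefficient survives. *)
Lemma size_gamma_sum d (gamma : nat -> nat) :
  let q := \sum_(0 <= j < d./2.+1) (gamma j)%:R *: ('X^j * (1 + 'X) ^+ (d - 2 * j)) : {poly int} in
  q.[0] != 0 -> size q = d.+1.
Proof.
move=> q; rewrite /q big_mkord big_ord_recl /= expr0 mul1r muln0 subn0.
set r := \sum_(_ < _) _; have r0 : r.[0] = 0.
  rewrite horner_sum big1 // => j _; rewrite hornerZ hornerM hornerXn /= expr0n /=.
  by rewrite mul0r mulr0.
have szr : (size r <= d)%N.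
  apply: (leq_trans (size_sum _ _ _)); apply/bigmax_leqP => j _.
  apply: (leq_trans (size_scale_leq _ _)); apply: (leq_trans (size_polyMleq _ _)).
  rewrite size_polyXn size_exp_1DX.
  have := ltn_ord j; rewrite /bump /=; move: (nat_of_ord j) => k kd; lia.
rewrite hornerD r0 addr0 hornerZ => g0.
have gn : (gamma 0%N)%:R != 0 :> int by apply: contraNneq g0 => ->; rewrite mul0r.
have sz : size ((gamma 0%N)%:R *: (1 + 'X) ^+ d : {poly int}) = d.+1.
  by rewrite size_scale // size_exp_1DX.
by rewrite size_polyDl sz.
Qed.

Theorem theorem1p2 (R : realType) (T : finType) (e : rel T) (n k : nat)
    (esym : symmetric e) (eirr : irreflexive e) (echordal : chordal e)
    (hn : #|T| = n) (hk : n_comp e T = k) :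
  gamma_positive (map_poly (intr : int -> R) ((-1) ^+ (n - k) *: mobius_poly e)).
Proof.
(* Each component contributes its number of vertices minus one, the formal degree given by
   [bpoly_sgpos]; the sum is n - k. *)
pose d := \sum_(C in components e) #|C|.-1.
have dE : (n - k)%N = d.
  rewrite -hn -hk -card_components // -cardsT (card_partition (partition_components esym)).
  rewrite -sum1_card /d; apply/eqP; rewrite -(eqn_add2r (\sum_(C in components e) 1)) subnK.
    rewrite -big_split; apply/eqP/eq_bigr => C Ccomp /=; rewrite addn1 prednK //.
    by rewrite card_gt0 (conn_neq0 (conn_components esym Ccomp)).
  apply: leq_sum => C Ccomp.
  by rewrite card_gt0 (conn_neq0 (conn_components esym Ccomp)).
have pos C : C \in components e ->
    sgpos #|C|.-1 (bpoly e C) /\ 0 < (-1) ^+ #|C|.-1 * (bpoly e C).[0].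
  move=> Ccomp; have Cc := conn_components esym Ccomp.
  have Cn : #|C| = #|C|.-1.+1 by rewrite prednK // card_gt0 (conn_neq0 Cc).
  by have [] := bpoly_sgpos esym Cc (chordal_simplicial_hereditary esym eirr echordal) Cn.
have sg : sgpos d (mobius_poly e).
  by rewrite mobius_poly_prod //; apply: sgpos_prod => C /pos[].
(* The sign splits over the components, so the constant term is a product of positive integers;
   [size_gamma_sum] then gives the exact degree. *)
have at0 : ((-1) ^+ d *: mobius_poly e).[0] != 0.
  rewrite gt_eqF // hornerZ mobius_poly_prod // horner_prod /d -prodrXr -big_split /=.
  by apply: prodr_gt0 => C /pos[].
have [gamma gE] := sgpos_gamma sg; rewrite dE.
exists d, (fun j => (gamma j)%:R); split.
- by rewrite size_map_inj_poly //; [rewrite gE size_gamma_sum -?gE | exact: intr_inj].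
- by move=> j _; rewrite ler0n.
rewrite gE rmorph_sum /=; apply: eq_bigr => j _.
by rewrite map_polyZ rmorph_nat rmorphM !rmorphXn rmorphD rmorph1 /= !map_polyX.
Qed.
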